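(* Let $(M,\alpha)$ be a strict contact manifold and let $[\cdot,\cdot]$ be the Jacobi bracket on $\mathcal{C}^\infty(M,\mathbb{R})$. Then $(\mathcal{C}^\infty(M,\mathbb{R}),[\cdot,\cdot])$ is a Lie algebra.
   Context: A strict contact manifold $(M,\alpha)$ is a $(2n+1)$-dimensional smooth manifold $M$ with a smooth 1-form $\alpha$ such that $\alpha\wedge(d\alpha)^n$ is nowhere zero. The Reeb vector field $R_\alpha$ is the unique vector field with $\iota_{R_\alpha}d\alpha=0$ and $\alpha(R_\alpha)=1$. For a smooth function $H$ on $M$, the contact Hamiltonian vector field $X_H$ is the unique vector field with $\alpha(X_H)=H$ and $\iota_{X_H}d\alpha=dH(R_\alpha)\alpha-dH$. The Jacobi bracket of $f,g\in\mathcal{C}^\infty(M,\mathbb{R})$ is the smooth function $[f,g]=\alpha([X_f,X_g])$, where $[X_f,X_g]$ is the Lie bracket of vector fields. Lie algebras are over $\mathbb{R}$. *)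

(* Defs.v *)
From HB Require Import structures.
From mathcomp Require Import all_boot all_order all_algebra all_fingroup.
From mathcomp Require Import all_classical all_reals all_analysis.
Set Implicit Arguments.
Unset Strict Implicit.
Unset Printing Implicit Defensive.
Import Order.TTheory GRing.Theory Num.Theory.
Import numFieldNormedType.Exports.
Local Open Scope classical_set_scope.
Local Open Scope ring_scope.

Section SmoothMaps.
Context {R : realType} {m : nat} {W : normedModType R}.

(* [class_C k U f]: the iterated partial derivatives of [f] of order at most
   [k] exist and are continuous at every point of [U].  This only depends on
   the values of [f] on [U] when [U] is open, the only case used below. *)
Fixpoint class_C (k : nat) (U : set 'rV[R]_m) (f : 'rV[R]_m -> W) : Prop :=
  (forall x, U x -> {for x, continuous f}) /\
  if k is k'.+1 then
    forall j : 'I_m, (forall x, U x -> derivable f x (delta_mx 0 j)) /\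
                     class_C k' U ('D_(delta_mx 0 j) f)
  else True.

Definition smooth_on (U : set 'rV[R]_m) (f : 'rV[R]_m -> W) : Prop :=
  forall k, class_C k U f.

End SmoothMaps.

(* A Hausdorff, second countable space with a smooth atlas.  The map [chart i]
   is only meaningful on [chart_dom i], and [ichart i] on the image of that set
   under [chart i]; their other values are irrelevant. *)
Record smoothManifold (R : realType) (m : nat) := SmoothManifold {
  carrier :> topologicalType ;
  carrier_hausdorff : hausdorff_space carrier ;
  carrier_second_countable : @second_countable carrier ;
  chart_idx : Type ;
  chart_dom : chart_idx -> set carrier ;
  chart : chart_idx -> carrier -> 'rV[R]_m ;
  ichart : chart_idx -> 'rV[R]_m -> carrier ;
  dom_open : forall i, open (chart_dom i) ;
  dom_cover : forall p, exists i, chart_dom i p ;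
  img_open : forall i, open (chart i @` chart_dom i) ;
  chartK : forall i p, chart_dom i p -> ichart i (chart i p) = p ;
  chart_continuous : forall i, {within chart_dom i, continuous (chart i)} ;
  ichart_continuous : forall i,
    {within chart i @` chart_dom i, continuous (ichart i)} ;
  transition_smooth : forall i j,
    smooth_on (chart i @` (chart_dom i `&` chart_dom j)) (chart j \o ichart i)
}.

Section Manifold.
Context {R : realType} {m : nat} {M : smoothManifold R m}.
Implicit Types (p : M) (i j : chart_idx M) (f : M -> R).

Definition chart_img i : set 'rV[R]_m := chart i @` chart_dom i.

Definition chart_at p : chart_idx M := projT1 (cid (dom_cover p)).

Definition smooth f : Prop := forall i, smooth_on (chart_img i) (f \o ichart i).

(* A tangent vector at [p] is a family of coordinate vectors, one for each chart
   around [p], related by the differentials of the transition maps.  The zero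
   value at the other charts makes the family representing a given tangent
   vector unique. *)
Definition tangent p (v : chart_idx M -> 'rV[R]_m) : Prop :=
  (forall i j, chart_dom i p -> chart_dom j p ->
     v j = 'D_(v i) (chart j \o ichart i) (chart i p)) /\
  (forall i, ~ chart_dom i p -> v i = 0).

Definition tangent_family := M -> chart_idx M -> 'rV[R]_m.

Definition vector_field (X : tangent_family) : Prop :=
  (forall p, tangent p (X p)) /\
  (forall i, smooth_on (chart_img i) (fun x => X (ichart i x) i)).

Definition lie_bracket (X Y : tangent_family) : tangent_family := fun p i =>
  if `[< chart_dom i p >] then
    'D_(X p i) (fun x => Y (ichart i x) i) (chart i p) -
    'D_(Y p i) (fun x => X (ichart i x) i) (chart i p)
  else 0.

(* A differential form of degree [k] is given, at [p] and in each chart around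
   [p], by its value on the [k] tangent vectors whose coordinates are the rows
   of a matrix.  Values at charts which do not contain [p] are ignored. *)
Definition diff_form (k : nat) := M -> chart_idx M -> 'M[R]_(k, m) -> R.

Definition form_eq k (w w' : diff_form k) : Prop :=
  forall p i, chart_dom i p -> w p i =1 w' p i.

Definition one_form (a : diff_form 1) : Prop :=
  [/\ forall p i, chart_dom i p -> linear (a p i : 'rV[R]_m -> R^o),
      forall p i j v, chart_dom i p -> chart_dom j p ->
        a p i v = a p j ('D_v (chart j \o ichart i) (chart i p)) &
      forall i k,
        smooth_on (chart_img i) (fun x => a (ichart i x) i (delta_mx 0 k))].

Definition contract (a : diff_form 1) (X : tangent_family) : M -> R :=
  fun p => a p (chart_at p) (X p (chart_at p)).

Definition interior_product k (X : tangent_family) (w : diff_form (1 + k)) :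
    diff_form k :=
  fun p i v => w p i (col_mx (X p i) v).

Definition differential f : diff_form 1 :=
  fun p i v => 'D_v (f \o ichart i) (chart i p).

(* In coordinates, d(\sum_k a_k dx_k)(u, v) is the sum over k, l of
   (d a_l / d x_k) (u_k v_l - v_k u_l). *)
Definition ext_deriv (a : diff_form 1) : diff_form (1 + 1) := fun p i w =>
  'D_(usubmx w) (fun x => a (ichart i x) i (dsubmx w)) (chart i p) -
  'D_(dsubmx w) (fun x => a (ichart i x) i (usubmx w)) (chart i p).

Definition wedge_prod k l (w : diff_form k) (w' : diff_form l) :
    diff_form (k + l) := fun p i v =>
  (k`! * l`!)%:R^-1 *
  \sum_(s : 'S_(k + l)) (-1) ^+ s *
    (w p i (usubmx (row_perm s v)) * w' p i (dsubmx (row_perm s v))).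

Fixpoint wedge_pow (w : diff_form 2) (n : nat) : diff_form n.*2 :=
  if n is n'.+1 return diff_form n.*2 then wedge_prod w (@wedge_pow w n')
  else fun _ _ _ => 1.

Definition nowhere_zero k (w : diff_form k) : Prop :=
  forall p i, chart_dom i p -> exists v, w p i v <> 0.

End Manifold.
Arguments tangent_family {R m} M.
Arguments diff_form {R m} M k.
Arguments wedge_pow {R m M} w n _ _ _.

Section Contact.
Context {R : realType} {n : nat} {M : smoothManifold R n.*2.+1}.
Implicit Types (a : diff_form M 1) (H f g : M -> R) (X : tangent_family M).

Definition strict_contact a : Prop :=
  one_form a /\ nowhere_zero (wedge_prod a (wedge_pow (ext_deriv a) n)).

Definition is_reeb a X : Prop :=
  [/\ vector_field X,
      form_eq (interior_product X (ext_deriv a)) (fun _ _ _ => 0) &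
      contract a X = cst 1].

(* [xget] selects the unique vector field with the given property. *)
Definition reeb a : tangent_family M :=
  xget (fun _ _ => 0) [set X | is_reeb a X].

Definition is_contact_hamiltonian a H X : Prop :=
  [/\ vector_field X,
      contract a X = H &
      form_eq (interior_product X (ext_deriv a))
        (fun p i v => contract (differential H) (reeb a) p * a p i v -
                      differential H p i v)].

Definition contact_hamiltonian a H : tangent_family M :=
  xget (fun _ _ => 0) [set X | is_contact_hamiltonian a H X].

Definition jacobi_bracket a f g : M -> R :=
  contract a (lie_bracket (contact_hamiltonian a f) (contact_hamiltonian a g)).

End Contact.

(* The subset [S] of [V] is a linear subspace and [br] restricts to a Lie
   algebra bracket on it. *)
Record lie_algebra_on (R : realType) (V : lmodType R) (S : set V)
    (br : V -> V -> V) : Prop := LieAlgebraOn {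
  lie_carrier0 : S 0 ;
  lie_carrier_linear : forall (c : R) x y, S x -> S y -> S (c *: x + y) ;
  lie_closed : forall x y, S x -> S y -> S (br x y) ;
  lie_linear_l : forall (c : R) x y z, S x -> S y -> S z ->
    br (c *: x + y) z = c *: br x z + br y z ;
  lie_linear_r : forall (c : R) x y z, S x -> S y -> S z ->
    br z (c *: x + y) = c *: br z x + br z y ;
  lie_alternating : forall x, S x -> br x x = 0 ;
  lie_jacobi : forall x y z, S x -> S y -> S z ->
    br x (br y z) + br y (br z x) + br z (br x y) = 0
}.

(* Main.v *)
From HB Require Import structures.
From mathcomp Require Import all_boot all_order all_algebra all_fingroup.
From mathcomp Require Import all_classical all_reals all_analysis.
From mathcomp Require Import ring lra.
Require Import Defs.
Set Implicit Arguments.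
Unset Strict Implicit.
Unset Printing Implicit Defensive.
Import Order.TTheory GRing.Theory Num.Theory.
Import numFieldNormedType.Exports.
Local Open Scope classical_set_scope.
Local Open Scope ring_scope.

(** The fields [reeb alpha] and [contact_hamiltonian alpha f], written [R] and
[X_f] in these comments, are chosen among the solutions of their defining
equations, so the existence of solutions has to be proved.  It is linear algebra
carried out smoothly.  At a point, a vector killed
by both [alpha] and [dalpha] is killed by the top degree form
[alpha /\ dalpha ^ n], which is not zero, so it is zero ([contact_kernel0]).  A
skew form in odd dimension has a kernel, hence there is a vector with
[dalpha(r, _) = 0] and [alpha(r) = 1], and the bilinear form
[dalpha + alpha * alpha] is nondegenerate.  Inverting its matrix turns every
one-form into a smooth vector field ([sharp_exists]): the dual of [alpha] is the
Reeb field, and the dual of [(R(f) + f) alpha - df] is [X_f].  These local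
solutions fit together over all charts because [dalpha] transforms like a
two-form ([dform_change]); this rests on the symmetry of second derivatives and
on the chain rule, hence on the differentiability of functions with continuous
partial derivatives ([schwarz], [C1_differentiable]).

Cartan's formula for [alpha([X, Y])], together with
[dalpha(X_f, _) = R(f) alpha - df], gives

  [[f, g] = X_f(g) - R(f) g]

([jacobi_bracketE]).  So the bracket of smooth functions is smooth and linear in
[g], and it is antisymmetric because the Lie bracket of vector fields is.

The Jacobi identity comes from [d(dalpha) = 0] ([dform_closed]), evaluated on
[X_f], [X_g] and [X_h]:

  [\sum X_f(dalpha(X_g, X_h)) = \sum dalpha([X_f, X_g], X_h)],

the sums running over the cyclic permutations of [f], [g], [h].  Here
[dalpha(X_g, X_h) = X_g(h) - X_h(g) - [g, h]] and
[dalpha([X_f, X_g], X_h) = X_f(X_g(h)) - X_g(X_f(h)) - R(h) [f, g]].  The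
iterated derivatives cancel in the cyclic sums, leaving
[\sum X_f([g, h]) = \sum R(f) [g, h]]; since
[[f, [g, h]] = X_f([g, h]) - R(f) [g, h]], this is the Jacobi identity. *)

(** * Mean value theorem and symmetry of second derivatives *)

Lemma norm_sub_le_split (R : realFieldType) (e a b c : R) :
  `|a - c| <= e / 2 -> `|b - c| <= e / 2 -> `|a - b| <= e.
Proof. by rewrite !ler_norml => /andP[? ?] /andP[? ?]; apply/andP; split; lra. Qed.

Section Lines.
Context {R : realType} {V : normedModType R}.
Implicit Types (f : V -> R) (x y u v : V).

Let line_quotient (W : normedModType R) (f : V -> W) x v (t : R) :
  (fun h : R => h^-1 *: ((f \o shift (x + t *: v)) (h *: v) - f (x + t *: v)))
  = (fun h : R => h^-1 *: (((fun s : R => f (x + s *: v)) \o shift t)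
      (h *: (1 : R)) - f (x + t *: v))).
Proof.
by apply/funext => h /=; rewrite [h *: 1]mulr1 scalerDl addrCA.
Qed.

Lemma derivable_line (W : normedModType R) (f : V -> W) x v (t : R) :
  derivable f (x + t *: v) v -> derivable (fun s : R => f (x + s *: v)) t 1.
Proof. by rewrite /derivable line_quotient. Qed.

Lemma derive_line (W : normedModType R) (f : V -> W) x v (t : R) :
  'D_1 (fun s : R => f (x + s *: v)) t = 'D_v f (x + t *: v).
Proof. by rewrite /derive line_quotient. Qed.

(** The sign of [s] is free, because the increments to which this applies are
coordinates of an arbitrary vector. *)
Lemma MVT_line f x v (s : R) :
  (forall t : R, `|t| <= `|s| -> derivable f (x + t *: v) v) ->
  exists2 t : R, `|t| <= `|s| & f (x + s *: v) - f x = s * 'D_v f (x + t *: v).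
Proof.
move=> df; pose g (t : R) := f (x + t *: v).
have dg (t : R) : `|t| <= `|s| -> is_derive t 1 g ('D_v f (x + t *: v)).
  by move=> /df/derivable_line dft; apply: DeriveDef; [|exact: derive_line].
have g0 : g 0 = f x by rewrite /g scale0r addr0.
have cg (a b : R) : `|a| <= `|s| -> `|b| <= `|s| ->
    {within `[a, b], continuous g}.
  move=> ha hb; apply: derivable_within_continuous => t.
  rewrite in_itv /= => /andP[h1 h2]; have [] // := dg t.
  move: ha hb; rewrite !ler_norml => /andP[? ?] /andP[? ?]; lra.
have [s0|s0] := leP 0 s.
  have /= [||t] := @MVT_segment R g (fun t => 'D_v f (x + t *: v)) 0 s s0.
  - move=> t; rewrite in_itv /= => /andP[h1 h2]; apply: dg.
    by rewrite !ger0_norm// ltW.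
  - by apply: cg; rewrite ?normr0.
  - rewrite in_itv /= => /andP[h1 h2]; rewrite subr0 g0 => E.
    by exists t; [rewrite !ger0_norm | rewrite mulrC].
have /= [||t] := @MVT_segment R g (fun t => 'D_v f (x + t *: v)) s 0 (ltW s0).
- move=> t; rewrite in_itv /= => /andP[h1 h2]; apply: dg.
  by rewrite !ltr0_norm // lerN2 ltW.
- by apply: cg; rewrite ?normr0.
- rewrite in_itv /= => /andP[h1 h2]; rewrite sub0r g0 => E.
  exists t; first by rewrite !ler0_norm ?lerN2 // ltW.
  by rewrite -[LHS]opprB -/(g s) E; ring.
Qed.

(** The second difference is the increment of [y |-> f (y + s *: v) - f y] along
[u]; applying the mean value theorem along [u] and then along [v] turns it into
a mixed derivative at an intermediate point.  It is symmetric in [u] and [v],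
which is what makes the mixed derivatives agree in the limit. *)
Lemma second_difference f x u v (s : R) :
  (forall a b : R, `|a| <= `|s| -> `|b| <= `|s| ->
    derivable f (x + a *: u + b *: v) u /\
    derivable ('D_u f) (x + a *: u + b *: v) v) ->
  exists a b : R, [/\ `|a| <= `|s|, `|b| <= `|s| &
    f (x + s *: u + s *: v) - f (x + s *: u) - (f (x + s *: v) - f x) =
    s * (s * 'D_v ('D_u f) (x + a *: u + b *: v))].
Proof.
move=> df.
have s0 : `|(0 : R)| <= `|s| by rewrite normr0.
pose g y := f (y + s *: v) - f y.
have dsh y : derivable f (y + s *: v) u ->
    is_derive y u (fun y => f (y + s *: v)) ('D_u f (y + s *: v)).
  have E : (fun h : R => h^-1 *: ((f \o shift (y + s *: v)) (h *: u) -
             f (y + s *: v))) =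
    (fun h : R => h^-1 *: (((fun y => f (y + s *: v)) \o shift y) (h *: u) -
             f (y + s *: v))) by apply/funext => h /=; rewrite addrA.
  move=> H; apply: DeriveDef; first by rewrite /derivable -E.
  by rewrite /derive -E.
have [t ts E] : exists2 t : R, `|t| <= `|s| &
    g (x + s *: u) - g x = s * 'D_u g (x + t *: u).
  apply: MVT_line => t ts; apply: derivableB.
    by have [] := dsh _ (df t s ts (lexx _)).1.
  by have [] := df t 0 ts s0; rewrite scale0r addr0.
have [b bs E'] : exists2 b : R, `|b| <= `|s| &
    'D_u f (x + t *: u + s *: v) - 'D_u f (x + t *: u) =
     s * 'D_v ('D_u f) (x + t *: u + b *: v).
  by apply: (@MVT_line (fun y => 'D_u f y)) => b bs; exact: (df t b ts bs).2.
exists t, b; split=> //; rewrite -E'; move: E; rewrite /g => ->; congr (_ * _).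
have [d1 e1] := dsh _ (df t s ts (lexx _)).1.
have d0 : derivable f (x + t *: u) u.
  by have [] := df t 0 ts s0; rewrite scale0r addr0.
by rewrite (deriveB d1 d0) e1.
Qed.

(** The same second difference of step [s] equals [s ^+ 2] times either mixed
derivative, each at a point near [x]; continuity brings both values within any
[e] of each other at [x]. *)
Lemma schwarz f x u v :
  (\forall y \near x, [/\ derivable f y u, derivable f y v,
     derivable ('D_u f) y v & derivable ('D_v f) y u]) ->
  {for x, continuous ('D_v ('D_u f))} ->
  {for x, continuous ('D_u ('D_v f))} ->
  'D_v ('D_u f) x = 'D_u ('D_v f) x.
Proof.
move=> df c1 c2; apply/eqP; rewrite -subr_eq0 -normr_eq0.
rewrite eq_le normr_ge0 andbT; apply/ler_addgt0Pl => e e0; rewrite addr0.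
have e2 : 0 < e / 2 by rewrite divr_gt0.
move/cvgrPdist_le : c1 => /(_ _ e2) c1; move/cvgrPdist_le : c2 => /(_ _ e2) c2.
have [r /= r0 rP] := (nbhs_ballP x _).1 (filterI df (filterI c1 c2)).
(* A step small enough for the parallelogram spanned by s *: u and s *: v to
   stay in the ball where both hypotheses hold; the summand 1 covers the case
   u = v = 0. *)
pose s := r / (2 * (`|u| + `|v| + 1)).
have d0 : 0 < `|u| + `|v| + 1 by rewrite ltr_wpDl // addr_ge0.
have s0 : 0 < s by rewrite divr_gt0 // mulr_gt0.
have sP (a b : R) : `|a| <= `|s| -> `|b| <= `|s| -> ball x r (x + a *: u + b *: v).
  rewrite (gtr0_norm s0) => ha hb; rewrite -ball_normE /= -addrA opprD addNKr.
  rewrite normrN (le_lt_trans (ler_normD _ _)) // !normrZ.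
  apply: (@le_lt_trans _ _ (s * (`|u| + `|v| + 1))).
    rewrite !mulrDr -[leLHS]addr0 !lerD ?ler_wpM2r //.
    by rewrite mulr1 ltW.
  rewrite /s invfM mulrA mulfVK ?gt_eqF //; lra.
have [|a [b [ha hb Eab]]] := @second_difference f x u v s.
  move=> a b ha hb; have [[d1 _ d2 _] _] := rP _ (sP _ _ ha hb).
  by split; [exact: d1|exact: d2].
have [|b' [a' [hb' ha' Eba]]] := @second_difference f x v u s.
  move=> b' a' hb' ha'; rewrite addrAC.
  have [[_ d1 _ d2] _] := rP _ (sP _ _ ha' hb').
  by split; [exact: d1|exact: d2].
have [_ [+ _]] := rP _ (sP _ _ ha hb).
have [_ [_ +]] := rP _ (sP _ _ ha' hb').
move: Eba; rewrite [x + b' *: v + _]addrAC [x + s *: v + _]addrAC => Eba.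
have -> : 'D_u ('D_v f) (x + a' *: u + b' *: v) =
          'D_v ('D_u f) (x + a *: u + b *: v).
  have sn0 : s != 0 by rewrite gt_eqF.
  have subC4 (a1 a2 a3 a4 : R) : a1 - a2 - (a3 - a4) = a1 - a3 - (a2 - a4).
    by ring.
  apply: (mulfI sn0); apply: (mulfI sn0).
  exact: etrans (esym Eba) (etrans (subC4 _ _ _ _) Eab).
move=> h1 h2; exact: (norm_sub_le_split h2 h1).
Qed.
End Lines.

(** * Differentiability from continuous partial derivatives *)

Lemma continuous_sum_at (R : realType) (T : topologicalType) (I : Type)
    (r : seq I) (F : I -> T -> R) x :
  (forall i, {for x, continuous (F i)}) ->
  {for x, continuous (fun y => \sum_(i <- r) F i y)}.
Proof.
move=> cF; elim: r => [|i r IHr]; rewrite /prop_for /=.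
  have <- : cst 0 = (fun y => \sum_(i <- [::]) F i y).
    by apply/funext => y; rewrite big_nil.
  exact: cvg_cst.
have <- : F i + (fun y => \sum_(i <- r) F i y) =
    (fun y => \sum_(i <- i :: r) F i y).
  by apply/funext => y; rewrite big_cons.
exact: (continuousD (cF i) IHr).
Qed.

Section ContinuouslyDifferentiable.
Context {R : realType} {m : nat}.
Implicit Types (f : 'rV[R]_m -> R) (x h : 'rV[R]_m) (U : set 'rV[R]_m).

Lemma differentiable_littleo (V W : normedModType R) (f : V -> W)
    (df : {linear V -> W}) (x : V) :
  continuous df -> f \o shift x = cst (f x) + df +o_ 0 id -> differentiable f x.
Proof. by move=> dfc fx; apply/diff_locallyP; rewrite (diff_unique dfc fx). Qed.

Lemma coord_le_norm h j : `|h 0 j| <= `|h|.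
Proof.
rewrite [leRHS]/Num.Def.normr /= mx_normrE.
exact: (le_bigmax _ (fun ij : 'I_1 * 'I_m => `|h ij.1 ij.2|) (0, j)).
Qed.

Lemma norm_le_coords h (c : R) :
  0 <= c -> (forall j, `|h 0 j| <= c) -> `|h| <= c.
Proof.
move=> c0 hc; rewrite [leLHS]/Num.Def.normr /= mx_normrE.
by apply: bigmax_le => // -[i j] _ /=; rewrite ord1.
Qed.

(** The vertices of the path from [0] to [h] that moves along one coordinate axis
at a time. *)
Definition row_trunc h (k : nat) : 'rV[R]_m :=
  \row_j (if (j < k)%N then h 0 j else 0).

Lemma row_trunc0 h : row_trunc h 0 = 0.
Proof. by apply/rowP => j; rewrite !mxE. Qed.

Lemma row_trunc_full h : row_trunc h m = h.
Proof. by apply/rowP => j; rewrite !mxE ltn_ord. Qed.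

Lemma row_truncS h (k : 'I_m) :
  row_trunc h k.+1 = row_trunc h k + h 0 k *: delta_mx 0 k.
Proof.
apply/rowP => j; rewrite !mxE eqxx /= ltnS leq_eqVlt.
have [<-|jk] := eqVneq j k; first by rewrite eqxx ltnn mulr1 add0r.
by rewrite -val_eqE in jk; rewrite (negPf jk) /= mulr0 addr0.
Qed.

(** The norm is the maximum of the coordinates, so the whole path stays in the
ball of radius [`|h|]. *)
Lemma row_trunc_norm h (k : 'I_m) (t : R) : `|t| <= `|h 0 k| ->
  `|row_trunc h k + t *: delta_mx 0 k| <= `|h|.
Proof.
move=> th; apply: norm_le_coords => // j; rewrite !mxE eqxx /=.
have [->|jk] := eqVneq j k.
  by rewrite ltnn mulr1 add0r (le_trans th) // coord_le_norm.
by rewrite mulr0 addr0; case: ifP => _; rewrite ?normr0 // coord_le_norm.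
Qed.

(** Along the path of the [row_trunc h k], each step changes one coordinate, so
the mean value theorem compares the increment of [f] with the partial derivative
at [x] up to a small multiple of [`|h|]. *)
Lemma C1_differentiable f x :
  (forall j, \forall y \near x, derivable f y (delta_mx 0 j)) ->
  (forall j, {for x, continuous ('D_(delta_mx 0 j) f)}) ->
  differentiable f x.
Proof.
move=> df cf.
pose d h : R := \sum_j h 0 j * 'D_(delta_mx 0 j) f x.
have lin_d : linear (d : 'rV[R]_m -> R^o).
  move=> c u v; rewrite /d scaler_sumr -big_split /=; apply: eq_bigr => j _.
  by rewrite !mxE mulrDl -[c *: _]/(c * _) mulrA.
pose dM := GRing.isLinear.Build _ _ _ _ _ lin_d.
pose dL : {linear 'rV[R]_m -> R^o} := HB.pack (d : 'rV[R]_m -> R^o) dM.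
apply: (@differentiable_littleo _ _ _ dL).
  rewrite -[continuous _]/(continuous (d : _ -> R)) => y; rewrite /d.
  apply: continuous_sum_at => j.
  apply: continuousM; first exact: coord_continuous.
  by apply: cst_continuous.
apply/eqaddoP => _/posnumP[e].
(* There are m steps, each contributing at most e / (m + 1) times the norm;
   m + 1 avoids a division by zero in dimension 0. *)
have e0 : 0 < e%:num / m.+1%:R by rewrite divr_gt0.
have : \forall y \near x, forall j : 'I_m, derivable f y (delta_mx 0 j) /\
   `|'D_(delta_mx 0 j) f x - 'D_(delta_mx 0 j) f y| <= e%:num / m.+1%:R.
  apply: (@filter_forall _ _ (fun (j : 'I_m) y => derivable f y (delta_mx 0 j) /\
    `|'D_(delta_mx 0 j) f x - 'D_(delta_mx 0 j) f y| <= e%:num / m.+1%:R)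
    (nbhs x)) => j.
  near=> y; split; near: y; first exact: df.
  exact: ((cvgrPdist_le _ _).1 (cf j)).
move=> /(nbhs_ballP x _).1 [r /= r0 rP].
have near_r : \forall h \near (0 : 'rV[R]_m), `|h| < r.
  by apply/(nbhs_ballP (0 : 'rV[R]_m) _); exists r => //= h;
     rewrite -ball_normE /= sub0r normrN.
apply: filterS near_r => h hr.
rewrite -![(_ + _ : _ -> _) _]/(_ + _) -![(- _ : _ -> _) _]/(- _) /=.
have -> : f (h + x) - (cst (f x) h + d h) =
    \sum_(j < m) (f (x + row_trunc h j.+1) - f (x + row_trunc h j)
       - h 0 j * 'D_(delta_mx 0 j) f x).
  rewrite sumrB -/(d h) -(big_mkord xpredT (fun j => f (x + row_trunc h j.+1)
     - f (x + row_trunc h j))) telescope_sumr // row_trunc_full row_trunc0.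
  by rewrite addr0 [x + h]addrC /= opprD addrA.
apply: (le_trans (ler_norm_sum _ _ _)).
apply: (@le_trans _ _ (\sum_(j < m) (e%:num / m.+1%:R * `|h|))).
  apply: ler_sum => j _.
  have inb (t : R) : `|t| <= `|h 0 j| ->
      ball x r (x + row_trunc h j + t *: delta_mx 0 j).
    move=> th; rewrite -ball_normE /= -addrA opprD addNKr normrN.
    by rewrite (le_lt_trans _ hr) // row_trunc_norm.
  have [|t th] := @MVT_line _ _ f (x + row_trunc h j) (delta_mx 0 j) (h 0 j).
    by move=> t th; have [] := rP _ (inb _ th) j.
  rewrite -addrA -row_truncS => ->; rewrite -mulrBr normrM mulrC.
  apply: ler_pM => //; last exact: coord_le_norm.
  by rewrite distrC; have [] := rP _ (inb _ th) j.
rewrite sumr_const card_ord -(mulr_natl (_ * _)) mulrA ler_wpM2r //.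
by rewrite mulrCA ler_piMr // ler_pdivrMr // mul1r ler_nat.
Unshelve. all: by end_near. Qed.

Lemma derive_sum_partial (f : 'rV[R]_m -> R) x (v : 'rV[R]_m) : differentiable f x ->
  'D_v f x = \sum_j v 0 j * 'D_(delta_mx 0 j) f x.
Proof.
move=> df; rewrite deriveE // {1}(row_sum_delta v) linear_sum /=.
by apply: eq_bigr => j _; rewrite linearZ /= deriveE.
Qed.

End ContinuouslyDifferentiable.

(** * Smooth functions on open sets *)

Section Deriv.
Context {R : realType} {V : normedModType R}.
Implicit Types (f g : V -> R) (x v : V).

Lemma derive_add_fun f g x v : derivable f x v -> derivable g x v ->
  'D_v (fun y => f y + g y) x = 'D_v f x + 'D_v g x.
Proof. exact: deriveD. Qed.

Lemma derive_mul_fun f g x v : derivable f x v -> derivable g x v ->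
  'D_v (fun y => f y * g y) x = f x * 'D_v g x + g x * 'D_v f x.
Proof. exact: deriveM. Qed.

Lemma derive_sum_fun n (F : 'I_n -> V -> R) x v :
  (forall i, derivable (F i) x v) ->
  'D_v (fun y => \sum_i F i y) x = \sum_i 'D_v (F i) x.
Proof. by move=> dF; rewrite -derive_sum // fct_sumE. Qed.

Lemma chain_rule (V' W : normedModType R) (f : V -> V') (g : V' -> W) x v :
  differentiable f x -> differentiable g (f x) ->
  'D_v (g \o f) x = 'D_('D_v f x) g (f x).
Proof.
move=> df dg; rewrite !deriveE //; last exact: differentiable_comp.
by rewrite diff_comp.
Qed.

Lemma derivable_scale_fun (c : R) (f : V -> R) x v : derivable f x v ->
  derivable (fun y => c * f y) x v.
Proof. by move=> df; exact: (derivableM (derivable_cst c x v) df). Qed.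

Lemma derive_scale_fun (c : R) (f : V -> R) x v : derivable f x v ->
  'D_v (fun y => c * f y) x = c * 'D_v f x.
Proof.
move=> df; have dc : derivable (cst c : V -> R) x v by exact: derivable_cst.
by rewrite (derive_mul_fun dc df) derive_cst mulr0 addr0.
Qed.

End Deriv.

Section ClassC.
Context {R : realType} {m : nat} {W : normedModType R}.
Implicit Types (f g : 'rV[R]_m -> W) (U : set 'rV[R]_m) (k : nat).

Lemma class_C_weaken k U f : class_C k.+1 U f -> class_C k U f.
Proof.
elim: k f => [|k IHk] f [cf df]; first by split.
by split=> // j; have [dj /IHk] := df j.
Qed.

Lemma class_C_continuous k U f :
  class_C k U f -> forall x, U x -> {for x, continuous f}.
Proof. by case: k => [|k] []. Qed.

Lemma near_open U x : open U -> U x -> \forall y \near x, U y.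
Proof. by move=> Uo Ux; exact: open_nbhs_nbhs. Qed.

(** Derivatives at a point of an open set see only the values on that set.  This
is what allows every smoothness proof below to replace a function by a formula
that holds on the image of a chart. *)
Lemma class_C_ext k U f g : open U -> (forall x, U x -> f x = g x) ->
  class_C k U f -> class_C k U g.
Proof.
move=> Uo; elim: k f g => [|k IHk] f g fg fC.
all: have nfg x : U x -> \forall y \near x, f y = g y
  by move=> Ux; apply: filterS (near_open Uo Ux) => y /fg.
  have [cf _] := fC; split=> // x Ux; rewrite /prop_for /continuous_at -fg //.
  by apply: (cvg_trans (near_eq_cvg (nfg x Ux)) (cf x Ux)).
have [cf df] := fC; split.
  apply: class_C_continuous (IHk f g fg (class_C_weaken fC)).
move=> j; have [dj cj] := df j; split=> [x Ux|].
  exact: near_eq_derivable (nfg x Ux) (dj x Ux).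
apply: (IHk ('D_(delta_mx 0 j) f)) => // x Ux.
exact/near_eq_derive/nfg.
Qed.

Lemma class_C_cst k U (c : W) : class_C k U (cst c).
Proof.
elim: k c => [|k IHk] c; first by split=> // x _; exact: cst_continuous.
split=> [x _|j]; first exact: cst_continuous.
split=> [x _|]; first exact: derivable_cst.
by rewrite (_ : 'D_ _ _ = cst 0) //; apply/funext => x; rewrite derive_cst.
Qed.

Lemma smooth_on_ext U f g : open U -> (forall x, U x -> f x = g x) ->
  smooth_on U f -> smooth_on U g.
Proof. by move=> Uo fg sf k; exact: class_C_ext fg (sf k). Qed.

Lemma smooth_on_cst U (c : W) : smooth_on U (fun=> c).
Proof. by move=> k; exact: class_C_cst. Qed.

Lemma smooth_on_continuous U f x : smooth_on U f -> U x -> {for x, continuous f}.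
Proof. by move=> sf; exact: class_C_continuous (sf 0%N) _. Qed.

Lemma smooth_on_partial U f j : smooth_on U f -> smooth_on U ('D_(delta_mx 0 j) f).
Proof. by move=> sf k; have [_ /(_ j)[]] := sf k.+1. Qed.

Lemma smooth_on_derivable_partial U f x j : smooth_on U f -> U x ->
  derivable f x (delta_mx 0 j).
Proof. by move=> sf Ux; have [_ /(_ j)[+ _]] := sf 1%N; exact. Qed.

End ClassC.

Section ScalarSmooth.
Context {R : realType} {m : nat}.
Implicit Types (f g : 'rV[R]_m -> R) (U : set 'rV[R]_m) (k : nat).

Lemma class_C_add k U f g : open U -> class_C k U f -> class_C k U g ->
  class_C k U (fun x => f x + g x).
Proof.
move=> Uo; elim: k f g => [|k IHk] f g fC gC.
  by split=> // x Ux; apply: continuousD;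
     [exact: class_C_continuous fC _ Ux|exact: class_C_continuous gC _ Ux].
split=> [|j].
  exact: class_C_continuous (IHk _ _ (class_C_weaken fC) (class_C_weaken gC)).
have [[_ /(_ j)[df fC']] [_ /(_ j)[dg gC']]] := (fC, gC).
split=> [x Ux|]; first by apply: derivableD; [exact: df|exact: dg].
apply: class_C_ext (IHk _ _ fC' gC') => // x Ux.
by rewrite derive_add_fun; [|exact: df|exact: dg].
Qed.

Lemma class_C_mul k U f g : open U -> class_C k U f -> class_C k U g ->
  class_C k U (fun x => f x * g x).
Proof.
move=> Uo; elim: k f g => [|k IHk] f g fC gC.
  by split=> // x Ux; apply: continuousM;
     [exact: class_C_continuous fC _ Ux|exact: class_C_continuous gC _ Ux].
split=> [|j].
  exact: class_C_continuous (IHk _ _ (class_C_weaken fC) (class_C_weaken gC)).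
have [[_ /(_ j)[df fC']] [_ /(_ j)[dg gC']]] := (fC, gC).
split=> [x Ux|]; first by apply: derivableM; [exact: df|exact: dg].
have fgC := IHk _ _ (class_C_weaken fC) gC'.
have gfC := IHk _ _ (class_C_weaken gC) fC'.
apply: class_C_ext (class_C_add Uo fgC gfC) => // x Ux.
by rewrite derive_mul_fun; [|exact: df|exact: dg].
Qed.

Lemma class_C_inv k U f : open U -> (forall x, U x -> f x != 0) ->
  class_C k U f -> class_C k U (fun x => (f x)^-1).
Proof.
move=> Uo fn0; elim: k => [|k IHk] fC.
  by split=> // x Ux; apply: continuousV; [exact: fn0|exact: class_C_continuous fC _ Ux].
have iC := IHk (class_C_weaken fC); have [_ df] := fC.
split=> [|j]; first exact: class_C_continuous iC.
have [dj fC'] := df j.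
split=> [x Ux|]; first by apply: derivableV; [exact: fn0|exact: dj].
have C2 := class_C_mul Uo (class_C_cst k U (-1 : R)) (class_C_mul Uo iC iC).
apply: class_C_ext (class_C_mul Uo C2 fC') => // x Ux.
have := @deriveV _ _ f x (delta_mx 0 j) (fn0 x Ux) (dj x Ux).
by rewrite /= => ->; rewrite /cst mulN1r -invfM -expr2.
Qed.

Lemma smooth_on_add U f g : open U -> smooth_on U f -> smooth_on U g ->
  smooth_on U (fun x => f x + g x).
Proof. by move=> Uo sf sg k; exact: class_C_add. Qed.

Lemma smooth_on_mul U f g : open U -> smooth_on U f -> smooth_on U g ->
  smooth_on U (fun x => f x * g x).
Proof. by move=> Uo sf sg k; exact: class_C_mul. Qed.

Lemma smooth_on_inv U f : open U -> (forall x, U x -> f x != 0) ->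
  smooth_on U f -> smooth_on U (fun x => (f x)^-1).
Proof. by move=> Uo fn0 sf k; exact: class_C_inv. Qed.

Lemma smooth_on_opp U f : open U -> smooth_on U f -> smooth_on U (fun x => - f x).
Proof.
move=> Uo sf; apply: smooth_on_ext (smooth_on_mul Uo (smooth_on_cst U (-1 : R)) sf) => //.
by move=> x _; rewrite mulN1r.
Qed.

Lemma smooth_on_sub U f g : open U -> smooth_on U f -> smooth_on U g ->
  smooth_on U (fun x => f x - g x).
Proof. by move=> Uo sf sg; apply: smooth_on_add => //; exact: smooth_on_opp. Qed.

Lemma smooth_on_sum (I : Type) (r : seq I) U (F : I -> 'rV[R]_m -> R) :
  open U -> (forall i, smooth_on U (F i)) ->
  smooth_on U (fun x => \sum_(i <- r) F i x).
Proof.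
move=> Uo sF; elim: r => [|i r IHr].
  by apply: smooth_on_ext (smooth_on_cst U (0 : R)) => // x _; rewrite big_nil.
by apply: smooth_on_ext (smooth_on_add Uo (sF i) IHr) => // x _; rewrite big_cons.
Qed.

Lemma smooth_on_prod (I : Type) (r : seq I) U (F : I -> 'rV[R]_m -> R) :
  open U -> (forall i, smooth_on U (F i)) ->
  smooth_on U (fun x => \prod_(i <- r) F i x).
Proof.
move=> Uo sF; elim: r => [|i r IHr].
  by apply: smooth_on_ext (smooth_on_cst U (1 : R)) => // x _; rewrite big_nil.
by apply: smooth_on_ext (smooth_on_mul Uo (sF i) IHr) => // x _; rewrite big_cons.
Qed.

Lemma smooth_on_det n U (A : 'rV[R]_m -> 'M[R]_n) : open U ->
  (forall i j, smooth_on U (fun x => A x i j)) -> smooth_on U (fun x => \det (A x)).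
Proof.
move=> Uo sA; apply: smooth_on_sum => // s.
apply: smooth_on_mul => //; first exact: smooth_on_cst.
by apply: smooth_on_prod => // i; exact: sA.
Qed.

(** Cramer's rule: the entries of the inverse are polynomials in the entries of
the matrix divided by its determinant. *)
Lemma smooth_on_invmx n U (A : 'rV[R]_m -> 'M[R]_n) : open U ->
  (forall x, U x -> A x \in unitmx) ->
  (forall i j, smooth_on U (fun x => A x i j)) ->
  forall i j, smooth_on U (fun x => invmx (A x) i j).
Proof.
move=> Uo uA sA i j.
have sadj : smooth_on U (fun x => \adj (A x) i j).
  have sc : smooth_on U (fun x => cofactor (A x) j i).
    apply: smooth_on_mul => //; first exact: smooth_on_cst.
    apply: smooth_on_det => // a b.
    by apply: smooth_on_ext (sA (lift j a) (lift i b)) => // x _; rewrite !mxE.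
  by apply: smooth_on_ext sc => // x _; rewrite mxE.
have sinv : smooth_on U (fun x => (\det (A x))^-1).
  apply: smooth_on_inv => //; last exact: smooth_on_det.
  by move=> x /uA; rewrite unitmxE unitfE.
apply: (smooth_on_ext Uo _ (smooth_on_mul Uo sinv sadj)) => x Ux.
by rewrite /invmx uA // [RHS]mxE.
Qed.

Lemma smooth_on_differentiable U f x : open U -> smooth_on U f -> U x ->
  differentiable f x.
Proof.
move=> Uo sf Ux; apply: C1_differentiable => j.
  apply: filterS (near_open Uo Ux) => y Uy.
  exact: smooth_on_derivable_partial sf Uy.
exact: smooth_on_continuous (smooth_on_partial j sf) Ux.
Qed.

Lemma smooth_on_derivable U f x v : open U -> smooth_on U f -> U x ->
  derivable f x v.
Proof. by move=> Uo sf Ux; exact/diff_derivable/(smooth_on_differentiable Uo sf). Qed.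

Lemma smooth_on_derive U f v : open U -> smooth_on U f -> smooth_on U ('D_v f).
Proof.
move=> Uo sf.
have s : smooth_on U (fun x => \sum_j v 0 j * 'D_(delta_mx 0 j) f x).
  apply: smooth_on_sum => // j; apply: smooth_on_mul => //.
    exact: smooth_on_cst.
  exact: smooth_on_partial.
apply: smooth_on_ext s => // x Ux; rewrite -derive_sum_partial //.
exact: (smooth_on_differentiable Uo sf).
Qed.

Lemma smooth_on_schwarz U f x u v : open U -> smooth_on U f -> U x ->
  'D_v ('D_u f) x = 'D_u ('D_v f) x.
Proof.
move=> Uo sf Ux.
have sD w := smooth_on_derive w Uo sf.
apply: schwarz.
- apply: filterS (near_open Uo Ux) => y Uy; split.
  + exact: (smooth_on_derivable Uo sf Uy).
  + exact: (smooth_on_derivable Uo sf Uy).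
  + exact: (smooth_on_derivable Uo (sD u) Uy).
  + exact: (smooth_on_derivable Uo (sD v) Uy).
- exact: (smooth_on_continuous (smooth_on_derive v Uo (sD u)) Ux).
- exact: (smooth_on_continuous (smooth_on_derive u Uo (sD v)) Ux).
Qed.

End ScalarSmooth.

Section VectorSmooth.
Context {R : realType} {m n : nat}.
Implicit Types (F : 'rV[R]_m -> 'rV[R]_n) (U : set 'rV[R]_m).

Lemma differentiable_rowP F x :
  (forall k, differentiable (fun y => F y 0 k) x) -> differentiable F x.
Proof.
move=> dF.
have -> : F = \sum_k (fun y => F y 0 k *: delta_mx 0 k).
  by rewrite fct_sumE; apply/funext => y; exact: row_sum_delta.
by apply: differentiable_sum => k; apply: differentiableZl.
Qed.

Lemma derive_row F x v k : derivable F x v ->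
  ('D_v F x) 0 k = 'D_v (fun y => F y 0 k) x.
Proof. by move=> dF; rewrite derive_mx // mxE. Qed.

Lemma continuous_row F x :
  {for x, continuous F} <-> forall j, {for x, continuous (fun x => F x 0 j)}.
Proof.
split=> [cF j|cF]; first exact: (continuous_comp cF (@coord_continuous _ _ _ 0 j _)).
apply: (@cvgrPdist_le _ _ _ (nbhs x) (nbhs_filter x) F (F x)).2 => /= e e0.
have near_e : \forall y \near x, forall j, `|F x 0 j - F y 0 j| <= e.
  apply: (@filter_forall _ _ (fun (j : 'I_n) y => `|F x 0 j - F y 0 j| <= e)
    (nbhs x)) => j.
  exact: ((cvgrPdist_le _ _).1 (cF j)).
apply: filterS near_e => y hy; apply: norm_le_coords; first exact: ltW.
by move=> j; rewrite !mxE.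
Qed.

(** Smoothness of vector-valued maps is reduced to that of their coordinates, so
that the mean value theorem is applied to scalar functions only. *)
Lemma class_C_row k U F : open U ->
  class_C k U F <-> forall j, class_C k U (fun x => F x 0 j).
Proof.
move=> Uo; elim: k F => [|k IHk] F.
  split=> [[cF _] j|cF]; split=> // x Ux; first exact: (continuous_row F x).1 (cF x Ux) j.
  by apply/continuous_row => j; have [+ _] := cF j; exact.
split=> [[cF dF] l|cF].
  split=> [x Ux|j]; first exact: (continuous_row F x).1 (cF x Ux) l.
  have [dj cj] := dF j; split=> [x Ux|].
    exact: ((derivable_mxP _ _ _).1 (dj x Ux)).
  apply: (class_C_ext Uo _ ((IHk _).1 cj l)) => x Ux.
  by rewrite derive_row //; exact: dj.
split=> [x Ux|j].
  by apply/continuous_row => j; have [+ _] := cF j; exact.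
have dF x : U x -> derivable F x (delta_mx 0 j).
  move=> Ux; apply/derivable_mxP => i l; rewrite ord1.
  by have [_ /(_ j)[+ _]] := cF l; exact.
split=> //; apply/IHk => l.
have [_ /(_ j)[_ cl]] := cF l.
by apply: (class_C_ext Uo _ cl) => x Ux; rewrite derive_row //; exact: dF.
Qed.

Lemma smooth_on_row U F : open U ->
  smooth_on U F <-> forall j, smooth_on U (fun x => F x 0 j).
Proof.
move=> Uo; split=> sF; first by move=> j k; exact: (class_C_row k F Uo).1 (sF k) j.
by move=> k; apply/class_C_row => // j; exact: sF.
Qed.

Lemma smooth_on_differentiable_row U F x : open U -> smooth_on U F -> U x ->
  differentiable F x.
Proof.
move=> Uo sF Ux; apply: differentiable_rowP => k.
exact: (smooth_on_differentiable Uo ((smooth_on_row F Uo).1 sF k) Ux).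
Qed.

End VectorSmooth.

(** * Forms as functions of the rows of a matrix *)

Section RowForms.
Context {R : realType} {m : nat}.

Definition set_row k (r : 'I_k) (u : 'rV[R]_m) (A : 'M[R]_(k, m)) : 'M[R]_(k, m) :=
  \matrix_(i, j) (if i == r then u 0 j else A i j).

Definition row_linear k (F : 'M[R]_(k, m) -> R) := forall r (A : 'M[R]_(k, m)),
  linear ((fun u => F (set_row r u A)) : 'rV[R]_m -> R^o).

(** When [F] is the coordinate expression of a form, this says that the interior
product of the form with [z] vanishes, whichever argument [z] is put in. *)
Definition killed_by (z : 'rV[R]_m) k (F : 'M[R]_(k, m) -> R) :=
  forall r A, F (set_row r z A) = 0.

Lemma set_row_id k (r : 'I_k) A : set_row r (row r A) A = A.
Proof. by apply/matrixP => i j; rewrite !mxE; case: eqP => [->|]. Qed.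

Lemma set_row1 (r : 'I_1) u A : set_row r u A = u.
Proof. by apply/matrixP => k l; rewrite !mxE !ord1 eqxx. Qed.

Lemma row_perm_set_row k (s : 'S_k) r u A :
  row_perm s (set_row r u A) = set_row (s^-1 r)%g u (row_perm s A).
Proof.
apply/matrixP => i j; rewrite !mxE; congr (if _ then _ else _).
by apply/eqP/eqP => [<-|->]; rewrite ?permK ?permKV.
Qed.

Lemma usubmx_set_rowl k l (r : 'I_k) u (A : 'M[R]_(k + l, m)) :
  usubmx (set_row (lshift l r) u A) = set_row r u (usubmx A).
Proof. by apply/matrixP => i j; rewrite !mxE (inj_eq (@lshift_inj _ _)). Qed.

Lemma dsubmx_set_rowl k l (r : 'I_k) u (A : 'M[R]_(k + l, m)) :
  dsubmx (set_row (lshift l r) u A) = dsubmx A.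
Proof. by apply/matrixP => i j; rewrite !mxE eq_rlshift. Qed.

Lemma usubmx_set_rowr k l (r : 'I_l) u (A : 'M[R]_(k + l, m)) :
  usubmx (set_row (rshift k r) u A) = usubmx A.
Proof. by apply/matrixP => i j; rewrite !mxE eq_lrshift. Qed.

Lemma dsubmx_set_rowr k l (r : 'I_l) u (A : 'M[R]_(k + l, m)) :
  dsubmx (set_row (rshift k r) u A) = set_row r u (dsubmx A).
Proof. by apply/matrixP => i j; rewrite !mxE (inj_eq (@rshift_inj _ _)). Qed.

Lemma mulmx_tr_inj (u w : 'rV[R]_m) :
  (forall v : 'rV_m, (u *m v^T) 0 0 = (w *m v^T) 0 0) -> u = w.
Proof.
move=> H; apply/rowP => k; have := H (delta_mx 0 k).
by rewrite trmx_delta -!colE !mxE.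
Qed.

(** A top degree form whose interior product with some [z != 0] vanishes is zero.
Some nontrivial combination of the rows of [A] is a multiple of [z]: if [A] is
invertible [z] itself is such a combination, and otherwise the rows are
dependent.  Put this combination in place of a row that occurs in it with a
nonzero coefficient: the value is zero, but by multilinearity and alternation it
is that coefficient times [F A]. *)
Lemma alternating_killed_eq0 (F : 'M[R]_m -> R) (z : 'rV[R]_m) :
  row_linear F -> (forall s A, F (row_perm s A) = (-1) ^+ s * F A) ->
  killed_by z F -> z != 0 -> forall A, F A = 0.
Proof.
move=> Flin Falt Fz z0 A.
have [c [t [c0 cA]]] : exists (c : 'rV[R]_m) t, c != 0 /\ c *m A = t *: z.
  have [uA|] := boolP (A \in unitmx).
    exists (z *m invmx A), 1; rewrite mulmxKV // scale1r; split=> //.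
    by apply: contra z0 => /eqP z0; rewrite -(mulmxKV uA z) z0 mul0mx.
  rewrite -row_free_unit -kermx_eq0 => kA.
  exists (nz_row (kermx A)), 0; rewrite nz_row_eq0 scale0r; split=> //.
  by apply/sub_kermxP; exact: nz_row_sub.
have [k ck] : exists k, c 0 k != 0.
  by apply/rV0Pn.
pose L u : R^o := F (set_row k u A).
have Llin : linear L by exact: Flin.
pose LL : {linear 'rV[R]_m -> R^o} := HB.pack L (GRing.isLinear.Build _ _ _ _ _ Llin).
have LZ b (u : 'rV[R]_m) : L (b *: u) = b * L u by rewrite -[LHS]/(LL (b *: u)) linearZ.
have : LL (c *m A) = 0 by rewrite cA -[LL _]/(L _) LZ /L Fz mulr0.
rewrite mulmx_sum_row linear_sum /= (bigD1 k) //= big1 ?addr0 => [|i ik].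
  rewrite LZ /L set_row_id => /eqP.
  by rewrite mulf_eq0 (negPf ck) => /eqP.
(* Only the term of row k survives: for i != k the matrix B has two equal rows,
   hence is fixed by the transposition of i and k. *)
rewrite LZ /L.
set B := set_row _ _ _.
have : row_perm (tperm i k) B = B.
  apply/matrixP => a b; rewrite !mxE; case: tpermP => [->|->|//].
    by rewrite eqxx (negPf ik).
  by rewrite eqxx (negPf ik).
move=> EB; have := Falt (tperm i k) B; rewrite EB odd_tperm ik expr1 mulN1r.
move=> FB; have -> : F B = 0 by lra.
by rewrite mulr0.
Qed.

End RowForms.

Section WedgeRows.
Context {R : realType} {m : nat} {M : smoothManifold R m}.
Variables (p : M) (i : chart_idx M).

Lemma wedge_prod_row_perm k l (w : diff_form M k) (w' : diff_form M l) t A :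
  wedge_prod w w' p i (row_perm t A) = (-1) ^+ t * wedge_prod w w' p i A.
Proof.
rewrite /wedge_prod mulrCA; congr (_ * _); rewrite mulr_sumr.
rewrite (reindex_inj (mulIg t^-1%g)) /=; apply: eq_bigr => s _.
by rewrite -row_permM mulgKV odd_permM odd_permV signr_addb [_ * (-1) ^+ t]mulrC -mulrA.
Qed.

Lemma wedge_prod_row_linear k l (w : diff_form M k) (w' : diff_form M l) :
  row_linear (w p i) -> row_linear (w' p i) ->
  row_linear (wedge_prod w w' p i).
Proof.
move=> lw lw' r A c u v; rewrite /wedge_prod -[_ *: (_ * _)]/(c * (_ * _)).
rewrite mulrCA -mulrDr; congr (_ * _); rewrite mulr_sumr -big_split /=.
apply: eq_bigr => s _; rewrite !row_perm_set_row.
case: (split_ordP (s^-1 r)%g) => q ->.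
  rewrite !usubmx_set_rowl !dsubmx_set_rowl.
  have -> := lw q (usubmx (row_perm s A)) c u v.
  rewrite -[_ *: w p i _]/(c * w p i _).
  by rewrite mulrDl mulrDr; congr (_ + _); rewrite -!mulrA mulrCA.
rewrite !usubmx_set_rowr !dsubmx_set_rowr.
have -> := lw' q (dsubmx (row_perm s A)) c u v.
rewrite -[_ *: w' p i _]/(c * w' p i _).
by rewrite mulrDr mulrDr; congr (_ + _); rewrite ![c * _]mulrC !mulrA.
Qed.

Lemma wedge_prod_killed z k l (w : diff_form M k) (w' : diff_form M l) :
  killed_by z (w p i) -> killed_by z (w' p i) ->
  killed_by z (wedge_prod w w' p i).
Proof.
move=> kw kw' r A; rewrite /wedge_prod big1 ?mulr0 // => s _.
rewrite row_perm_set_row; case: (split_ordP (s^-1 r)%g) => q ->.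
  by rewrite usubmx_set_rowl kw mul0r mulr0.
by rewrite dsubmx_set_rowr kw' !mulr0.
Qed.

Lemma wedge_pow_row_linear (w : diff_form M 2) n :
  row_linear (w p i) -> row_linear (wedge_pow w n p i).
Proof.
move=> lw; elim: n => [|n IHn]; first by case.
exact: (wedge_prod_row_linear lw IHn).
Qed.

Lemma wedge_pow_killed z (w : diff_form M 2) n :
  killed_by z (w p i) -> killed_by z (wedge_pow w n p i).
Proof.
move=> lw; elim: n => [|n IHn]; first by case.
exact: (wedge_prod_killed lw IHn).
Qed.

End WedgeRows.

(** * Linear algebra at one point of a contact manifold *)

Section PointwiseContact.
Context {R : realType} {m : nat}.
Variables (a : 'rV[R]_m) (Om : 'M[R]_m).
Hypothesis Om_anti : Om^T = - Om.
Hypothesis kernel0 : forall v : 'rV[R]_m, v *m Om = 0 -> v *m a^T = 0 -> v = 0.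

(** The Reeb vector: a skew matrix of odd size is singular, and [a] cannot vanish
on its kernel, so a kernel vector can be scaled to have [a] equal to [1]. *)
Lemma odd_skew_kernel : odd m ->
  exists r : 'rV[R]_m, r *m Om = 0 /\ r *m a^T = 1%:M.
Proof.
move=> om.
have dOm : \det Om = 0.
  have := det_tr Om; rewrite Om_anti -scaleN1r detZ -signr_odd om expr1 mulN1r.
  lra.
have kO : kermx Om != 0.
  by rewrite kermx_eq0 row_free_unit unitmxE dOm unitr0.
pose v := nz_row (kermx Om).
have vO : v *m Om = 0 by apply/sub_kermxP; exact: nz_row_sub.
have v0 : v != 0 by rewrite nz_row_eq0.
have va : (v *m a^T) 0 0 != 0.
  apply: contra v0 => /eqP va; apply/eqP/kernel0 => //.
  by rewrite [LHS]mx11_scalar va raddf0.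
exists (((v *m a^T) 0 0)^-1 *: v); rewrite -!scalemxAl vO scaler0; split=> //.
by rewrite [X in _ *: X]mx11_scalar scale_scalar_mx mulVf.
Qed.

(** The matrix of the bilinear form [dalpha + alpha * alpha].  Adding the square of
[alpha] to the degenerate form [dalpha] gives an isomorphism from tangent vectors
to covectors. *)
Definition contact_mx := Om + a^T *m a.

Lemma contact_mx_mulr_reeb (r v : 'rV[R]_m) :
  r *m Om = 0 -> r *m a^T = 1%:M -> v *m contact_mx *m r^T = v *m a^T.
Proof.
move=> rO ra; rewrite mulmxDr mulmxDl.
have -> : v *m Om *m r^T = 0.
  apply: trmx_inj; rewrite !trmx_mul trmxK Om_anti trmx0.
  by rewrite mulNmx mulmxN mulmxA rO mul0mx oppr0.
by rewrite add0r -!mulmxA -[a *m r^T]trmxK trmx_mul trmxK ra trmx1 mulmx1.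
Qed.

(** If [v] is in the kernel, pairing with the Reeb vector gives [alpha v = 0], hence
[v] is also in the kernel of [dalpha]. *)
Lemma contact_mx_unit : odd m -> contact_mx \in unitmx.
Proof.
move=> om; rewrite -row_free_unit -kermx_eq0.
apply/eqP/row_matrixP => j; rewrite row0.
have vB : row j (kermx contact_mx) *m contact_mx = 0.
  by rewrite -row_mul mulmx_ker row0.
set v := row _ _ in vB *.
have [r [rO ra]] := odd_skew_kernel om.
have va : v *m a^T = 0 by rewrite -(contact_mx_mulr_reeb v rO ra) vB mul0mx.
by apply: kernel0 => //; move: vB; rewrite mulmxDr mulmxA va mul0mx addr0.
Qed.

End PointwiseContact.

(** * Charts and transition maps *)

Section Charts.
Context {R : realType} {m : nat} {M : smoothManifold R m}.
Implicit Types (p : M) (i j : chart_idx M).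

Definition overlap i j : set 'rV[R]_m :=
  chart i @` (chart_dom i `&` chart_dom j).

Definition transition i j : 'rV[R]_m -> 'rV[R]_m := chart j \o ichart i.

Lemma chart_img_chart i p : chart_dom i p -> chart_img i (chart i p).
Proof. by move=> ip; exists p. Qed.

Lemma ichart_dom i x : chart_img i x -> chart_dom i (ichart i x).
Proof. by case=> p ip <-; rewrite chartK. Qed.

Lemma ichartK i x : chart_img i x -> chart i (ichart i x) = x.
Proof. by case=> p ip <-; rewrite chartK. Qed.

Lemma chart_at_dom p : chart_dom (chart_at p) p.
Proof. exact: (projT2 (cid (dom_cover p))). Qed.

Lemma overlap_chart i j p : chart_dom i p -> chart_dom j p ->
  overlap i j (chart i p).
Proof. by move=> ip jp; exists p. Qed.

Lemma overlap_img i j x : overlap i j x -> chart_img i x.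
Proof. by case=> p [ip _] <-; exists p. Qed.

Lemma overlap_dom i j x : overlap i j x -> chart_dom j (ichart i x).
Proof. by case=> p [ip jp] <-; rewrite chartK. Qed.

Lemma transition_overlap i j x : overlap i j x -> overlap j i (transition i j x).
Proof. by case=> p [ip jp] <-; rewrite /transition /= chartK //; exists p. Qed.

Lemma transitionK i j x : overlap i j x -> transition j i (transition i j x) = x.
Proof.
by case=> p [ip jp] <-; rewrite /transition /= [ichart i _]chartK // chartK.
Qed.

Lemma transition_chart i j p : chart_dom i p -> transition i j (chart i p) = chart j p.
Proof. by move=> ip; rewrite /transition /= chartK. Qed.

Lemma overlap_open i j : open (overlap i j).
Proof.
have -> : overlap i j = chart_img i `&` ichart i @^-1` chart_dom j.
  apply/seteqP; split=> x /= [].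
    by move=> p [ip jp] <-; split; [exists p | rewrite /= chartK].
  by move=> [p ip <-]; rewrite /= chartK // => jp; exists p.
have := @ichart_continuous _ _ M i.
rewrite continuous_open_subspace; last exact: img_open.
move=> cI; rewrite openE => x [xi xj].
have cx : {for x, continuous (ichart i)} by apply: cI; rewrite inE.
apply: filterI; first by apply: open_nbhs_nbhs; split=> //; exact: img_open.
by apply: cx; apply: open_nbhs_nbhs; split=> //; exact: dom_open.
Qed.

Lemma transition_smooth_on i j : smooth_on (overlap i j) (transition i j).
Proof. exact: transition_smooth. Qed.

Lemma transition_differentiable i j x : overlap i j x ->
  differentiable (transition i j) x.
Proof.
move=> ox.
exact: (smooth_on_differentiable_row (@overlap_open i j) (@transition_smooth_on i j) ox).
Qed.

(** The differential of a transition map is onto: chart changes carry arbitrary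
test vectors to arbitrary test vectors. *)
Lemma transition_deriveK i j x w : overlap i j x ->
  'D_('D_w (transition j i) (transition i j x)) (transition i j) x = w.
Proof.
move=> ox; have ox' := transition_overlap ox.
have {1}-> : x = transition j i (transition i j x) by rewrite transitionK.
rewrite -chain_rule; [|exact: transition_differentiable|]; last first.
  by rewrite transitionK //; exact: transition_differentiable.
rewrite -[RHS](derive_id (transition i j x) w); apply: near_eq_derive.
have H := near_open (@overlap_open j i) ox'.
by apply: filterS H => y oy; exact: transitionK.
Qed.

End Charts.

(** * One-forms and vector fields in charts *)

Section OneForms.
Context {R : realType} {m : nat} {M : smoothManifold R m}.
Implicit Types (p : M) (i j : chart_idx M) (f g h : M -> R) (b c : diff_form M 1)
  (X Y : tangent_family M).

Lemma one_form_sum b p i (v : 'rV[R]_m) : one_form b -> chart_dom i p ->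
  b p i v = \sum_k v 0 k * b p i (delta_mx 0 k).
Proof.
move=> [lb _ _] ip.
pose L : {linear 'rV[R]_m -> R^o} :=
  HB.pack (b p i : 'rV[R]_m -> R^o) (GRing.isLinear.Build _ _ _ _ _ (lb p i ip)).
rewrite -[LHS]/(L v) {1}(row_sum_delta v) linear_sum.
by apply: eq_bigr => k _; rewrite linearZ.
Qed.

Lemma one_form_opp b p i (u : 'rV[R]_m) : one_form b -> chart_dom i p ->
  b p i (- u) = - b p i u.
Proof.
move=> ob ip; rewrite (one_form_sum u ob ip) (one_form_sum (- u) ob ip) -sumrN.
by apply: eq_bigr => k _; rewrite mxE mulNr.
Qed.

Lemma one_form_smooth_on b i (v : 'rV[R]_m) : one_form b ->
  smooth_on (chart_img i) (fun x => b (ichart i x) i v).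
Proof.
move=> ob; have [_ _ sb] := ob.
have s : smooth_on (chart_img i)
    (fun x => \sum_k v 0 k * b (ichart i x) i (delta_mx 0 k)).
  apply: smooth_on_sum => [|k]; first exact: img_open.
  by apply: smooth_on_mul; [exact: img_open|exact: smooth_on_cst|exact: sb].
apply: (smooth_on_ext _ _ s) => [|x /ichart_dom ix]; first exact: img_open.
by rewrite -one_form_sum.
Qed.

Lemma one_form_change b p i j (v : 'rV[R]_m) : one_form b ->
  chart_dom i p -> chart_dom j p ->
  b p i v = b p j ('D_v (transition i j) (chart i p)).
Proof. by move=> [_ tb _]; exact: tb. Qed.

Lemma one_form_sub_scale h b c : smooth h -> one_form b -> one_form c ->
  one_form (fun p i v => h p * b p i v - c p i v).
Proof.
move=> sh ob oc; have [lb tb sb] := ob; have [lc tc sc] := oc; split.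
- move=> p i ip r u v; rewrite lb // lc //.
  rewrite -[r *: b p i u]/(r * _) -[r *: c p i u]/(r * _).
  rewrite -[r *: (_ - _)]/(r * _); ring.
- by move=> p i j v ip jp; rewrite (tb _ i j) // (tc _ i j).
- move=> i k; have io := @img_open _ _ M i.
  by apply: smooth_on_sub => //; apply: smooth_on_mul => //; exact: sh.
Qed.

Lemma vector_field_change X p i j : vector_field X ->
  chart_dom i p -> chart_dom j p ->
  X p j = 'D_(X p i) (transition i j) (chart i p).
Proof. by move=> [tX _] ip jp; have [+ _] := tX p; exact. Qed.

Lemma vector_field_coord_smooth X i k : vector_field X ->
  smooth_on (chart_img i) (fun x => X (ichart i x) i 0 k).
Proof.
move=> [_ sX]; apply: (smooth_on_row (fun x => X (ichart i x) i) _).1.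
  exact: img_open.
exact: sX.
Qed.

(** [contract] is evaluated in a chosen chart; by the transformation rules of
one-forms and vectors, any chart around the point gives the same value. *)
Lemma contract_chart b X p i : one_form b -> vector_field X -> chart_dom i p ->
  contract b X p = b p i (X p i).
Proof.
move=> ob vX ip; rewrite /contract.
have cp := chart_at_dom p.
by rewrite [RHS](one_form_change _ ob ip cp) -(vector_field_change vX ip cp).
Qed.

Lemma contract_smooth b X : one_form b -> vector_field X -> smooth (contract b X).
Proof.
move=> ob vX i; have io := @img_open _ _ M i.
have s : smooth_on (chart_img i)
    (fun x => \sum_k X (ichart i x) i 0 k * b (ichart i x) i (delta_mx 0 k)).
  apply: smooth_on_sum => // k; apply: smooth_on_mul => //.
    exact: vector_field_coord_smooth.
  exact: one_form_smooth_on.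
apply: (smooth_on_ext io _ s) => x /ichart_dom ix.
by rewrite /= (contract_chart ob vX ix) one_form_sum.
Qed.

Lemma smooth_differentiable f i p : smooth f -> chart_dom i p ->
  differentiable (f \o ichart i) (chart i p).
Proof.
move=> sf ip; have io := @img_open _ _ M i.
exact: (smooth_on_differentiable io (sf i) (chart_img_chart ip)).
Qed.

Lemma smooth0 : smooth (0 : M -> R^o).
Proof. by move=> i; exact: smooth_on_cst. Qed.

Lemma smooth_linear (r : R) (f g : M -> R^o) :
  smooth f -> smooth g -> smooth (r *: f + g).
Proof.
move=> sf sg i; have io := @img_open _ _ M i.
exact: (smooth_on_add io (smooth_on_mul io (smooth_on_cst _ r) (sf i)) (sg i)).
Qed.

Lemma smooth_add f g : smooth f -> smooth g -> smooth (fun p => f p + g p).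
Proof.
move=> sf sg i; have io := @img_open _ _ M i.
exact: (smooth_on_add io (sf i) (sg i)).
Qed.

Lemma smooth_change f i j x : overlap i j x ->
  \forall y \near x, (f \o ichart i) y = ((f \o ichart j) \o transition i j) y.
Proof.
move=> ox; have H := near_open (@overlap_open _ _ _ i j) ox.
apply: filterS H => y oy.
by rewrite /transition /= chartK //; exact: overlap_dom oy.
Qed.

Lemma one_form_differential f : smooth f -> one_form (differential f).
Proof.
move=> sf; split.
- move=> p i ip r u v; have df := smooth_differentiable sf ip.
  by rewrite /differential !deriveE // linearP.
- move=> p i j v ip jp; rewrite /differential.
  have ox := overlap_chart ip jp.
  rewrite (near_eq_derive _ (smooth_change f ox)) chain_rule.
  + by rewrite transition_chart.
  + exact: transition_differentiable.
  + by rewrite transition_chart //; exact: smooth_differentiable.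
- move=> i k; have io := @img_open _ _ M i.
  have s := smooth_on_derive (delta_mx 0 k) io (sf i).
  by apply: (smooth_on_ext io _ s) => x /ichartK xK; rewrite /differential xK.
Qed.

(** The exterior derivative of [b] as a function of two tangent vectors instead of
a two-row matrix. *)
Definition dform b p i (u v : 'rV[R]_m) : R :=
  'D_u (fun x => b (ichart i x) i v) (chart i p) -
  'D_v (fun x => b (ichart i x) i u) (chart i p).

Lemma ext_deriv_dform b p i u v : ext_deriv b p i (col_mx u v) = dform b p i u v.
Proof. by rewrite /ext_deriv col_mxKu col_mxKd. Qed.

Lemma interior_product_dform b X p i v :
  interior_product X (ext_deriv b) p i v = dform b p i (X p i) v.
Proof. exact: ext_deriv_dform. Qed.

Lemma dform_anti b p i u v : dform b p i v u = - dform b p i u v.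
Proof. by rewrite /dform opprB. Qed.

Definition dform_mx b p i : 'M[R]_m :=
  \matrix_(k, l) dform b p i (delta_mx 0 k) (delta_mx 0 l).

Lemma derive_one_form b p i u v : one_form b -> chart_dom i p ->
  'D_u (fun x => b (ichart i x) i v) (chart i p) =
  \sum_l v 0 l * 'D_u (fun x => b (ichart i x) i (delta_mx 0 l)) (chart i p).
Proof.
move=> ob ip; have io := @img_open _ _ M i.
have xi := chart_img_chart ip.
have E : \forall x \near chart i p, b (ichart i x) i v =
    \sum_l v 0 l * b (ichart i x) i (delta_mx 0 l).
  apply: filterS (near_open io xi) => x /ichart_dom ix.
  exact: one_form_sum.
have db l := smooth_on_derivable (v := u) io (one_form_smooth_on i (delta_mx 0 l) ob) xi.
rewrite (near_eq_derive _ E) derive_sum_fun => [|l].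
  by apply: eq_bigr => l _; exact: derive_scale_fun.
exact: derivable_scale_fun.
Qed.

Lemma dform_sum b p i u v : one_form b -> chart_dom i p ->
  dform b p i u v = (u *m dform_mx b p i *m v^T) 0 0.
Proof.
move=> ob ip; have io := @img_open _ _ M i.
have xi := chart_img_chart ip.
have D w z : 'D_w (fun x => b (ichart i x) i z) (chart i p) =
    \sum_l \sum_k z 0 l * (w 0 k * 'D_(delta_mx 0 k)
       (fun x => b (ichart i x) i (delta_mx 0 l)) (chart i p)).
  rewrite derive_one_form //; apply: eq_bigr => l _; rewrite -mulr_sumr.
  congr (_ * _); apply: derive_sum_partial.
  exact: (smooth_on_differentiable io (one_form_smooth_on i (delta_mx 0 l) ob) xi).
rewrite mxE /dform !D [X in _ - X]exchange_big -sumrB; apply: eq_bigr => l _ /=.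
rewrite mxE mulr_suml -sumrB; apply: eq_bigr => k _.
by rewrite !mxE /dform mulrBr mulrBl; congr (_ - _); ring.
Qed.

Lemma dform_subl b p i (u v w : 'rV[R]_m) : one_form b ->
  chart_dom i p -> dform b p i (u - v) w = dform b p i u w - dform b p i v w.
Proof. by move=> ob ip; rewrite !dform_sum // !mulmxBl !mxE. Qed.

Lemma dform_mx_anti b p i : (dform_mx b p i)^T = - dform_mx b p i.
Proof. by apply/matrixP => k l; rewrite !mxE dform_anti. Qed.

(** The exterior derivative commutes with pullback by the transition map [ph].
Write [b] in chart [i] as [\sum_l (bj l \o ph) * d(ph_l)] and differentiate: the
terms with derivatives of [bj l] give the right-hand side, and those with second
derivatives of [ph] are symmetric in [u] and [v], so they cancel. *)
Lemma dform_change b p i j (u v : 'rV[R]_m) : one_form b ->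
  chart_dom i p -> chart_dom j p ->
  dform b p i u v = dform b p j ('D_u (transition i j) (chart i p))
                                ('D_v (transition i j) (chart i p)).
Proof.
move=> ob ip jp; have jo := @img_open _ _ M j.
have oo := @overlap_open _ _ M i j.
set x := chart i p; have ox : overlap i j x by exact: overlap_chart.
have phx : transition i j x = chart j p by rewrite transition_chart.
have xj : chart_img j (chart j p) by exact: chart_img_chart.
pose ph := transition i j.
pose bj l y := b (ichart j y) j (delta_mx 0 l).
have sph l : smooth_on (overlap i j) (fun y => ph y 0 l).
  exact: (smooth_on_row ph oo).1 (@transition_smooth_on _ _ M i j) l.
have dph y : overlap i j y -> differentiable ph y by exact: transition_differentiable.
have dbj l : differentiable (bj l) (ph x).
  by rewrite /ph phx; exact: (smooth_on_differentiable jo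
    (one_form_smooth_on j (delta_mx 0 l) ob) xj).
have key w z : 'D_w (fun y => b (ichart i y) i z) x =
    'D_('D_w ph x) (fun y => b (ichart j y) j ('D_z ph x)) (chart j p) +
    \sum_l bj l (ph x) * 'D_w ('D_z (fun y => ph y 0 l)) x.
  have E : \forall y \near x, b (ichart i y) i z =
      \sum_l 'D_z (fun y => ph y 0 l) y * (bj l \o ph) y.
    apply: filterS (near_open oo ox) => y oy.
    have iy := ichart_dom (overlap_img oy); have jy := overlap_dom oy.
    rewrite (one_form_change _ ob iy jy) (one_form_sum _ ob jy).
    apply: eq_bigr => l _; rewrite ichartK; last exact: overlap_img oy.
    rewrite derive_row; last exact/diff_derivable/dph.
    by rewrite /bj /= /ph /transition /= chartK.
  have d1 l : derivable ('D_z (fun y => ph y 0 l)) x w.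
    exact: (smooth_on_derivable oo (smooth_on_derive z oo (sph l)) ox).
  have d2 l : derivable (bj l \o ph) x w.
    exact/diff_derivable/(differentiable_comp (dph x ox) (dbj l)).
  rewrite (near_eq_derive _ E) derive_sum_fun => [|l]; last first.
    exact: (derivableM (d1 l) (d2 l)).
  rewrite derive_one_form // -big_split /=; apply: eq_bigr => l _.
  rewrite (derive_mul_fun (d1 l) (d2 l)) (chain_rule _ (dph x ox) (dbj l)).
  by rewrite derive_row; [rewrite {2}/ph phx|exact/diff_derivable/dph].
rewrite /dform -/x !key.
rewrite opprD addrACA -[RHS]addr0; congr (_ + _); apply/eqP; rewrite subr_eq0; apply/eqP.
apply: eq_bigr => l _; apply: (congr1 (fun t => bj l (ph x) * t)).
exact: (smooth_on_schwarz v u oo (sph l) ox).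
Qed.

End OneForms.

(** * Reeb and Hamiltonian vector fields *)

Section ContactForm.
Context {R : realType} {n : nat} {M : smoothManifold R n.*2.+1}.
Implicit Types (p : M) (i j : chart_idx M) (b c : diff_form M 1)
  (X Y : tangent_family M) (f g : M -> R).

Definition form_row b p i : 'rV[R]_(n.*2.+1) := \row_k b p i (delta_mx 0 k).

Lemma form_rowE b p i v : one_form b -> chart_dom i p ->
  b p i v = (v *m (form_row b p i)^T) 0 0.
Proof.
by move=> ob ip; rewrite (one_form_sum _ ob ip) mxE; apply: eq_bigr => k _; rewrite !mxE.
Qed.

Variable a : diff_form M 1.
Hypothesis contact_a : strict_contact a.

Let oa : one_form a. Proof. by case: contact_a. Qed.

Lemma ext_deriv_mx p i (A : 'M[R]_(1 + 1, n.*2.+1)) : chart_dom i p ->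
  ext_deriv a p i A = (usubmx A *m dform_mx a p i *m (dsubmx A)^T) 0 0.
Proof. by move=> ip; rewrite -(dform_sum _ _ oa ip). Qed.

Lemma ext_deriv_row_linear p i : chart_dom i p -> row_linear (ext_deriv a p i).
Proof.
move=> ip r A c u v; rewrite !ext_deriv_mx //.
case: (split_ordP r) => q ->.
  rewrite !usubmx_set_rowl !dsubmx_set_rowl !set_row1.
  by rewrite !mulmxDl -!scalemxAl !mxE.
rewrite !usubmx_set_rowr !dsubmx_set_rowr !set_row1.
by rewrite linearP /= mulmxDr -scalemxAr !mxE.
Qed.

Lemma one_form_row_linear p i : chart_dom i p -> row_linear (a p i).
Proof.
move=> ip r A c u v; rewrite !set_row1.
by have [la _ _] := oa; exact: la.
Qed.

(** This is where the contact condition is used: a vector killed by [alpha] and by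
[dalpha] is killed by their wedge product, a top degree form that would then
vanish at [p]. *)
Lemma contact_kernel0 p i (v : 'rV[R]_(n.*2.+1)) : chart_dom i p ->
  v *m dform_mx a p i = 0 -> v *m (form_row a p i)^T = 0 -> v = 0.
Proof.
move=> ip vO va; apply/eqP/negPn/negP => v0.
have [_ /(_ p i ip)[A]] := contact_a; apply.
apply: (@alternating_killed_eq0 _ _ _ v) => //.
- apply: (@wedge_prod_row_linear _ _ _ p i 1).
    exact: one_form_row_linear.
  exact/wedge_pow_row_linear/ext_deriv_row_linear.
- by move=> s B; exact: (@wedge_prod_row_perm _ _ _ p i 1).
- apply: (@wedge_prod_killed _ _ _ p i _ 1).
    by move=> r B; rewrite set_row1 form_rowE // va mxE.
  apply: wedge_pow_killed => r B; rewrite ext_deriv_mx //.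
  case: (@split_ordP 1 1 r) => q ->.
    by rewrite usubmx_set_rowl set_row1 vO mul0mx mxE.
  rewrite dsubmx_set_rowr set_row1 -mulmxA.
  have -> : dform_mx a p i *m v^T = 0.
    apply: trmx_inj; rewrite trmx_mul trmxK dform_mx_anti trmx0.
    by rewrite mulmxN vO oppr0.
  by rewrite mulmx0 mxE.
Qed.

Definition sharp_mx p i := contact_mx (form_row a p i) (dform_mx a p i).

Lemma sharp_mxE p i u v : chart_dom i p ->
  dform a p i u v + a p i u * a p i v = (u *m sharp_mx p i *m v^T) 0 0.
Proof.
move=> ip; rewrite dform_sum // mulmxDr mulmxDl [RHS]mxE; congr (_ + _).
rewrite !(form_rowE _ oa ip) mulmxA -mulmxA [RHS]mxE big_ord1; congr (_ * _).
by rewrite -[in RHS](trmxK (form_row a p i)) -trmx_mul [RHS]mxE.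
Qed.

Lemma sharp_mx_unit p i : chart_dom i p -> sharp_mx p i \in unitmx.
Proof.
move=> ip; apply: contact_mx_unit.
- exact: dform_mx_anti.
- by move=> v; exact: contact_kernel0.
- by rewrite /= odd_double.
Qed.

Lemma sharp_inj p i u w : chart_dom i p ->
  (forall v, dform a p i u v + a p i u * a p i v =
             dform a p i w v + a p i w * a p i v) -> u = w.
Proof.
move=> ip H; apply: (can_inj (mulmxK (sharp_mx_unit ip))).
by apply: mulmx_tr_inj => v; rewrite -!sharp_mxE.
Qed.

(** By definition of [dform] the entries are polynomials in the coefficients of
[a] and their partial derivatives. *)
Lemma sharp_mx_smooth i k l :
  smooth_on (chart_img i) (fun x => sharp_mx (ichart i x) i k l).
Proof.
have io := @img_open _ _ M i.
pose ak k x := a (ichart i x) i (delta_mx 0 k).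
have sa q : smooth_on (chart_img i) (ak q) by exact: one_form_smooth_on.
have s := smooth_on_add io (smooth_on_sub io
  (smooth_on_derive (delta_mx 0 k) io (sa l))
  (smooth_on_derive (delta_mx 0 l) io (sa k))) (smooth_on_mul io (sa k) (sa l)).
apply: (smooth_on_ext io _ s) => x xi.
by rewrite !mxE big_ord1 !mxE /dform ichartK.
Qed.

(** The musical isomorphism of [dalpha + alpha * alpha].  In each chart [X] is the
row of coefficients of [c] times the inverse matrix, which is smooth.  The images
of these vectors under a change of charts solve the same equation, by
[dform_change], so they agree by uniqueness of its solution. *)
Lemma sharp_exists c : one_form c -> exists X, vector_field X /\
  forall p i v, chart_dom i p ->
    dform a p i (X p i) v + a p i (X p i) * a p i v = c p i v.
Proof.
move=> oc.
pose X : tangent_family M := fun p i =>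
  if `[< chart_dom i p >] then form_row c p i *m invmx (sharp_mx p i) else 0.
have XE p i : chart_dom i p -> X p i = form_row c p i *m invmx (sharp_mx p i).
  by move=> ip; rewrite /X asboolT.
have Xc p i v : chart_dom i p ->
    dform a p i (X p i) v + a p i (X p i) * a p i v = c p i v.
  move=> ip; rewrite sharp_mxE // XE // mulmxKV ?sharp_mx_unit //.
  rewrite (form_rowE _ oc ip) -[in LHS](trmxK (form_row c p i)) -trmx_mul.
  by rewrite [LHS]mxE.
exists X; split=> //; split.
- move=> p; split=> [i j ip jp|i nip]; last by rewrite /X asboolF.
  rewrite -/(transition i j); set x := chart i p.
  have ox : overlap i j x by exact: overlap_chart.
  apply: (sharp_inj jp) => v; rewrite (Xc _ _ _ jp).
  pose w := 'D_v (transition j i) (chart j p).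
  have wv : 'D_w (transition i j) x = v.
    by have := transition_deriveK v ox; rewrite {1}transition_chart.
  rewrite -wv -(dform_change _ _ oa ip jp) -!(one_form_change _ oa ip jp) Xc //.
  by rewrite -(one_form_change _ oc ip jp).
- move=> i; have io := @img_open _ _ M i.
  apply/(smooth_on_row _ io) => k.
  have sc l : smooth_on (chart_img i) (fun x => c (ichart i x) i (delta_mx 0 l)).
    exact: one_form_smooth_on.
  have sB : forall l q, smooth_on (chart_img i)
      (fun x => invmx (sharp_mx (ichart i x) i) l q).
    apply: smooth_on_invmx => // [x /ichart_dom ix|l q].
      exact: sharp_mx_unit.
    exact: sharp_mx_smooth.
  have s : smooth_on (chart_img i) (fun x => \sum_l
      c (ichart i x) i (delta_mx 0 l) * invmx (sharp_mx (ichart i x) i) l k).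
    by apply: smooth_on_sum => // l; apply: smooth_on_mul.
  apply: (smooth_on_ext io _ s) => x /ichart_dom ix.
  by rewrite XE // mxE; apply: eq_bigr => l _; rewrite mxE.
Qed.

(** The Reeb field is the dual of [alpha] itself: the vector of [odd_skew_kernel]
solves the equation that defines that dual. *)
Lemma reeb_exists : exists X, is_reeb a X.
Proof.
have [X [vX Xa]] := sharp_exists oa.
have XR p i : chart_dom i p ->
    X p i *m dform_mx a p i = 0 /\ X p i *m (form_row a p i)^T = 1%:M.
  move=> ip.
  have [r [rO ra]] : exists r : 'rV[R]_(n.*2.+1),
      r *m dform_mx a p i = 0 /\ r *m (form_row a p i)^T = 1%:M.
    apply: odd_skew_kernel; first exact: dform_mx_anti.
      by move=> v; exact: contact_kernel0.
    by rewrite /= odd_double.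
  suff -> : X p i = r by [].
  apply: (sharp_inj ip) => v; rewrite Xa // dform_sum // rO mul0mx mxE add0r.
  by rewrite (form_rowE r oa ip) ra mxE eqxx mul1r.
exists X; split=> //.
- move=> p i ip v; rewrite interior_product_dform dform_sum //.
  by rewrite (XR p i ip).1 mul0mx mxE.
- apply/funext => p; have [i ip] := dom_cover p.
  by rewrite (contract_chart oa vX ip) (form_rowE _ oa ip) (XR p i ip).2 mxE.
Qed.

Lemma reebP : is_reeb a (reeb a).
Proof. exact: (xgetPex _ reeb_exists). Qed.

Definition reeb_der f := contract (differential f) (reeb a).

Lemma reeb_der_smooth f : smooth f -> smooth (reeb_der f).
Proof.
move=> sf; have [vR _ _] := reebP.
exact: (contract_smooth (one_form_differential sf) vR).
Qed.

(** Take the dual [X] of [(R(f) + f) alpha - df].  Evaluating its defining equation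
at the Reeb field gives [alpha(X) = f], and subtracting [f alpha] from both sides
leaves the equation for [dalpha(X, _)]. *)
Lemma contact_hamiltonian_exists f : smooth f ->
  exists X, is_contact_hamiltonian a f X.
Proof.
move=> sf; have [vR dR aR] := reebP.
have odf := one_form_differential sf.
have sRf := reeb_der_smooth sf.
have oc := one_form_sub_scale (smooth_add sRf sf) oa odf.
have [X [vX Xc]] := sharp_exists oc.
have aX p i : chart_dom i p -> a p i (X p i) = f p.
  move=> ip; have := Xc p i (reeb a p i) ip.
  rewrite dform_anti -interior_product_dform dR // oppr0 add0r.
  rewrite -(contract_chart oa vR ip) aR mulr1 mulr1.
  rewrite /reeb_der (contract_chart odf vR ip) => ->.
  by rewrite addrAC subrr add0r.
exists X; split=> //.
- apply/funext => p; have [i ip] := dom_cover p.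
  by rewrite (contract_chart oa vX ip) aX.
- move=> p i ip v; rewrite interior_product_dform.
  have := Xc p i v ip; rewrite aX // mulrDl -/(reeb_der f) => H.
  by apply: (addIr (f p * a p i v)); rewrite H; ring.
Qed.

Lemma contact_hamiltonianP f : smooth f ->
  is_contact_hamiltonian a f (contact_hamiltonian a f).
Proof. by move=> sf; exact: (xgetPex _ (contact_hamiltonian_exists sf)). Qed.

End ContactForm.

(** * Derivatives along vector fields *)

Section LocalFields.
Context {R : realType} {m : nat}.
Variables (U : set 'rV[R]_m) (x : 'rV[R]_m).
Hypotheses (oU : open U) (Ux : U x).

Lemma smooth_on_directional (V : 'rV[R]_m -> 'rV[R]_m) (h : 'rV[R]_m -> R) :
  smooth_on U V -> smooth_on U h -> smooth_on U (fun y => 'D_(V y) h y).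
Proof.
move=> sV sh.
have s : smooth_on U (fun y => \sum_k V y 0 k * 'D_(delta_mx 0 k) h y).
  apply: smooth_on_sum => // k; apply: smooth_on_mul => //.
    exact: (smooth_on_row V oU).1 sV k.
  exact: smooth_on_partial.
apply: (smooth_on_ext oU _ s) => y Uy.
by rewrite [RHS]derive_sum_partial //; exact: (smooth_on_differentiable oU sh Uy).
Qed.

(** The Leibniz rule for [y |-> 'D_(V y) h y], which depends on [y] both through
the point and through the direction. *)
Lemma derive_directional (V : 'rV[R]_m -> 'rV[R]_m) (h : 'rV[R]_m -> R) u :
  smooth_on U V -> smooth_on U h ->
  'D_u (fun y => 'D_(V y) h y) x = 'D_u ('D_(V x) h) x + 'D_('D_u V x) h x.
Proof.
move=> sV sh.
have dh y : U y -> differentiable h y.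
  by move=> Uy; exact: (smooth_on_differentiable oU sh Uy).
have sVk k : smooth_on U (fun y => V y 0 k) by exact: (smooth_on_row V oU).1 sV k.
pose dk k := 'D_(delta_mx 0 k) h.
have sdk k : smooth_on U (dk k) by exact: smooth_on_partial.
have ddk k : derivable (dk k) x u by exact: (smooth_on_derivable oU (sdk k) Ux).
have dV : derivable V x u.
  exact/diff_derivable/(smooth_on_differentiable_row oU sV Ux).
have dVk k : derivable (fun y => V y 0 k) x u.
  exact: (smooth_on_derivable oU (sVk k) Ux).
have E : \forall y \near x, 'D_(V y) h y = \sum_k V y 0 k * dk k y.
  by apply: filterS (near_open oU Ux) => y Uy; exact: (derive_sum_partial _ (dh y Uy)).
have E' : \forall y \near x, 'D_(V x) h y = \sum_k V x 0 k * dk k y.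
  by apply: filterS (near_open oU Ux) => y Uy; exact: (derive_sum_partial _ (dh y Uy)).
rewrite (near_eq_derive u E) (near_eq_derive u E') (derive_sum_partial _ (dh x Ux)).
rewrite derive_sum_fun => [|k]; last exact: (derivableM (dVk k) (ddk k)).
rewrite derive_sum_fun => [|k]; last exact: (derivable_scale_fun (ddk k)).
rewrite -big_split; apply: eq_bigr => k _ /=.
rewrite (derive_mul_fun (dVk k) (ddk k)) (derive_scale_fun _ (ddk k)).
by rewrite (derive_row _ dV) [dk k x * _]mulrC.
Qed.

End LocalFields.

Section Bracket.
Context {R : realType} {m : nat} {M : smoothManifold R m}.
Implicit Types (p : M) (i : chart_idx M) (b : diff_form M 1)
  (X Y Z : tangent_family M) (f g h : M -> R).

Definition coord_field X i : 'rV[R]_m -> 'rV[R]_m := fun x => X (ichart i x) i.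

Definition field_der X f : M -> R := contract (differential f) X.

Lemma coord_field_smooth X i : vector_field X ->
  smooth_on (chart_img i) (coord_field X i).
Proof. by move=> [_ sX]; exact: sX. Qed.

Lemma coord_field_derivable X i p u : vector_field X -> chart_dom i p ->
  derivable (coord_field X i) (chart i p) u.
Proof.
move=> vX ip; have io := @img_open _ _ M i.
apply: diff_derivable.
exact: (smooth_on_differentiable_row io (coord_field_smooth i vX) (chart_img_chart ip)).
Qed.

Lemma field_der_smooth X f : vector_field X -> smooth f -> smooth (field_der X f).
Proof. by move=> vX sf; exact: (contract_smooth (one_form_differential sf) vX). Qed.

Lemma field_der_chart X f p i : vector_field X -> smooth f -> chart_dom i p ->
  field_der X f p = 'D_(X p i) (f \o ichart i) (chart i p).
Proof. by move=> vX sf ip; exact: (contract_chart (one_form_differential sf) vX ip). Qed.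

Lemma field_der_linear X (r : R) (f g : M -> R^o) p : vector_field X ->
  smooth f -> smooth g ->
  field_der X (r *: f + g) p = r * field_der X f p + field_der X g p.
Proof.
move=> vX sf sg; have [i ip] := dom_cover p.
have sfg := smooth_linear r sf sg.
rewrite (field_der_chart vX sf ip) (field_der_chart vX sg ip).
rewrite (field_der_chart vX sfg ip).
have d k : smooth k -> derivable (k \o ichart i) (chart i p) (X p i).
  by move=> sk; apply: diff_derivable; exact: smooth_differentiable.
rewrite -(derive_scale_fun r (d f sf)).
exact: (derive_add_fun (derivable_scale_fun (d f sf)) (d g sg)).
Qed.

Lemma lie_bracket_chart X Y p i : chart_dom i p ->
  lie_bracket X Y p i = 'D_(X p i) (coord_field Y i) (chart i p) -
                        'D_(Y p i) (coord_field X i) (chart i p).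
Proof. by move=> ip; rewrite /lie_bracket asboolT. Qed.

Lemma derive_contract b Y p i u : one_form b -> vector_field Y -> chart_dom i p ->
  'D_u (contract b Y \o ichart i) (chart i p) =
  'D_u (fun x => b (ichart i x) i (Y p i)) (chart i p) +
  b p i ('D_u (coord_field Y i) (chart i p)).
Proof.
move=> ob vY ip; have io := @img_open _ _ M i; have xi := chart_img_chart ip.
have dY : derivable (coord_field Y i) (chart i p) u by exact: coord_field_derivable.
pose bk k x := b (ichart i x) i (delta_mx 0 k).
have dYk k : derivable (fun x => coord_field Y i x 0 k) (chart i p) u.
  exact: (smooth_on_derivable io (vector_field_coord_smooth i k vY) xi).
have dbk k : derivable (bk k) (chart i p) u.
  exact: (smooth_on_derivable io (one_form_smooth_on i (delta_mx 0 k) ob) xi).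
have E : \forall x \near chart i p, (contract b Y \o ichart i) x =
    \sum_k coord_field Y i x 0 k * bk k x.
  apply: filterS (near_open io xi) => x /ichart_dom ix.
  by rewrite /= (contract_chart ob vY ix) (one_form_sum _ ob ix).
rewrite (near_eq_derive u E) derive_sum_fun => [|k]; last first.
  exact: (derivableM (dYk k) (dbk k)).
rewrite (derive_one_form _ _ ob ip) (one_form_sum _ ob ip) -big_split /=.
apply: eq_bigr => k _; rewrite (derive_mul_fun (dYk k) (dbk k)).
by rewrite (derive_row _ dY) /bk /coord_field chartK // [X in _ + X]mulrC.
Qed.

(** Cartan's formula [b([X, Y]) = X(b(Y)) - Y(b(X)) - db(X, Y)], from the Leibniz
rule [derive_contract]. *)
Lemma cartan_formula b X Y p i : one_form b -> vector_field X -> vector_field Y ->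
  chart_dom i p ->
  b p i (lie_bracket X Y p i) =
  'D_(X p i) (contract b Y \o ichart i) (chart i p) -
  'D_(Y p i) (contract b X \o ichart i) (chart i p) - dform b p i (X p i) (Y p i).
Proof.
move=> ob vX vY ip; rewrite !derive_contract // lie_bracket_chart //.
have -> u v : b p i (u - v) = b p i u - b p i v.
  rewrite !(one_form_sum _ ob ip) -sumrB; apply: eq_bigr => k _.
  by rewrite !mxE mulrBl.
by rewrite /dform; ring.
Qed.

(** Cartan's formula for the closed form [dh]. *)
Lemma lie_bracket_der X Y h p i : vector_field X -> vector_field Y -> smooth h ->
  chart_dom i p ->
  differential h p i (lie_bracket X Y p i) =
  'D_(X p i) (field_der Y h \o ichart i) (chart i p) -
  'D_(Y p i) (field_der X h \o ichart i) (chart i p).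
Proof.
move=> vX vY sh ip; have odh := one_form_differential sh.
have io := @img_open _ _ M i; have xi := chart_img_chart ip.
rewrite (cartan_formula odh vX vY ip).
have dd u v : 'D_u (fun x => differential h (ichart i x) i v) (chart i p) =
    'D_u ('D_v (h \o ichart i)) (chart i p).
  apply: near_eq_derive; apply: filterS (near_open io xi) => x /ichartK xK.
  by rewrite /differential xK.
have -> : dform (differential h) p i (X p i) (Y p i) = 0; last by rewrite subr0.
rewrite /dform; apply/eqP; rewrite subr_eq0; apply/eqP.
apply: (etrans (dd _ _)); apply: (etrans _ (esym (dd _ _))).
exact: (smooth_on_schwarz (Y p i) (X p i) io (sh i) xi).
Qed.

(** The second derivative along [u] and [v] of the function [b(w)], for constant
[u], [v] and [w]. *)
Definition second_der b p i (u v w : 'rV[R]_m) : R :=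
  \sum_l w 0 l *
    'D_u ('D_v (fun x => b (ichart i x) i (delta_mx 0 l))) (chart i p).

Lemma second_derC b p i u v w : one_form b -> chart_dom i p ->
  second_der b p i u v w = second_der b p i v u w.
Proof.
move=> ob ip; have io := @img_open _ _ M i; have xi := chart_img_chart ip.
apply: eq_bigr => l _; apply: (congr1 (fun t => w 0 l * t)).
exact: (smooth_on_schwarz v u io (one_form_smooth_on i (delta_mx 0 l) ob) xi).
Qed.

(** The Leibniz rule for [db(X, Y)]: the first two terms differentiate the fields,
the last two differentiate the coefficients of [db]. *)
Lemma derive_dform b X Y p i u : one_form b -> vector_field X -> vector_field Y ->
  chart_dom i p ->
  'D_u (fun x => dform b (ichart i x) i (coord_field X i x) (coord_field Y i x))
    (chart i p) =
  dform b p i ('D_u (coord_field X i) (chart i p)) (Y p i) -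
  dform b p i ('D_u (coord_field Y i) (chart i p)) (X p i) +
  (second_der b p i u (X p i) (Y p i) - second_der b p i u (Y p i) (X p i)).
Proof.
move=> ob vX vY ip; have io := @img_open _ _ M i; have xi := chart_img_chart ip.
pose bl l x := b (ichart i x) i (delta_mx 0 l).
have sb l : smooth_on (chart_img i) (bl l) by exact: one_form_smooth_on.
(* T V W is the derivative along V of the coefficients of b, evaluated on W, so
   that db(X, Y) is the antisymmetrization of T. *)
pose T (V W : tangent_family M) x :=
  \sum_l coord_field W i x 0 l * 'D_(coord_field V i x) (bl l) x.
have dT V W l : vector_field V -> vector_field W ->
    derivable (fun x => coord_field W i x 0 l) (chart i p) u /\
    derivable (fun x => 'D_(coord_field V i x) (bl l) x) (chart i p) u.
  move=> vV vW; split.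
    exact: (smooth_on_derivable io (vector_field_coord_smooth i l vW) xi).
  have s := smooth_on_directional io (coord_field_smooth i vV) (sb l).
  exact: (smooth_on_derivable io s xi).
have E : \forall x \near chart i p,
    dform b (ichart i x) i (coord_field X i x) (coord_field Y i x) =
    T X Y x - T Y X x.
  apply: filterS (near_open io xi) => x xI; have ix := ichart_dom xI.
  by rewrite /dform !(derive_one_form _ _ ob ix) (ichartK xI).
have dTT V W : vector_field V -> vector_field W -> derivable (T V W) (chart i p) u.
  move=> vV vW.
  have s : smooth_on (chart_img i) (T V W).
    apply: smooth_on_sum => // l; apply: smooth_on_mul => //.
      exact: vector_field_coord_smooth.
    exact: (smooth_on_directional io (coord_field_smooth i vV) (sb l)).
  exact: (smooth_on_derivable io s xi).
have DT V W : vector_field V -> vector_field W -> 'D_u (T V W) (chart i p) =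
   'D_('D_u (coord_field V i) (chart i p)) (fun x => b (ichart i x) i (W p i)) (chart i p)
   + 'D_(V p i) (fun x => b (ichart i x) i ('D_u (coord_field W i) (chart i p)))
      (chart i p) + second_der b p i u (V p i) (W p i).
  move=> vV vW; rewrite derive_sum_fun => [|l]; last first.
    by have [d1 d2] := dT V W l vV vW; exact: (derivableM d1 d2).
  rewrite !(derive_one_form _ _ ob ip) -!big_split /=; apply: eq_bigr => l _.
  have [d1 d2] := dT V W l vV vW; rewrite (derive_mul_fun d1 d2).
  rewrite (derive_directional io xi u (coord_field_smooth i vV) (sb l)).
  rewrite (derive_row _ (coord_field_derivable (u := u) vW ip)).
  have alg (y q s d w : R) : y * (q + s) + d * w = y * s + w * d + y * q by ring.
  by rewrite /coord_field chartK // -/(bl l); exact: alg.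
rewrite (near_eq_derive u E).
have := deriveB (dTT X Y vX vY) (dTT Y X vY vX) => /= ->.
rewrite (DT X Y vX vY) (DT Y X vY vX) /dform.
have alg (s1 s2 q1 t1 t2 q2 : R) : s1 + s2 + q1 - (t1 + t2 + q2) =
  s1 - t2 - (t1 - s2) + (q1 - q2) by ring.
exact: alg.
Qed.

End Bracket.

(** * Closedness of an exact two-form *)

Section Closed.
Context {R : realType} {m : nat} {M : smoothManifold R m}.
Implicit Types (p : M) (i : chart_idx M) (X Y Z : tangent_family M).

Definition dform_field (b : diff_form M 1) i Y Z : 'rV[R]_m -> R :=
  fun x => dform b (ichart i x) i (coord_field Y i x) (coord_field Z i x).

(** The identity [d(db)(X, Y, Z) = 0].  In the cyclic sum, the second derivatives of
the coefficients cancel in pairs by [second_derC], and the derivatives of the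
fields assemble into Lie brackets. *)
Lemma dform_closed (b : diff_form M 1) X Y Z p i : one_form b ->
  vector_field X -> vector_field Y -> vector_field Z -> chart_dom i p ->
  'D_(X p i) (dform_field b i Y Z) (chart i p) +
  'D_(Y p i) (dform_field b i Z X) (chart i p) +
  'D_(Z p i) (dform_field b i X Y) (chart i p) =
  dform b p i (lie_bracket X Y p i) (Z p i) +
  dform b p i (lie_bracket Y Z p i) (X p i) +
  dform b p i (lie_bracket Z X p i) (Y p i).
Proof.
move=> ob vX vY vZ ip; have io := @img_open _ _ M i; have xi := chart_img_chart ip.
pose s V W T := dform b p i ('D_(V p i) (coord_field W i) (chart i p)) (T p i).
pose q (V W T : tangent_family M) := second_der b p i (V p i) (W p i) (T p i).
have L V W T : dform b p i (lie_bracket V W p i) (T p i) = s V W T - s W V T.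
  by rewrite lie_bracket_chart // dform_subl.
have D V W T : vector_field W -> vector_field T ->
    'D_(V p i) (dform_field b i W T) (chart i p) =
    s V W T - s V T W + (q V W T - q V T W).
  by move=> vW vT; exact: derive_dform.
have symq V W T : q V W T = q W V T by exact: second_derC.
have alg d1 d2 d3 l1 l2 l3 s1 s2 s3 s4 s5 s6 q1 q2 q3 q4 q5 q6 :
  d1 = s1 - s2 + (q1 - q2) -> d2 = s3 - s4 + (q3 - q4) ->
  d3 = s5 - s6 + (q5 - q6) -> l1 = s1 - s4 -> l2 = s3 - s6 -> l3 = s5 - s2 ->
  q4 = q1 -> q5 = q2 -> q6 = q3 -> d1 + d2 + d3 = l1 + l2 + l3 :> R.
  by move=> -> -> -> -> -> -> -> -> ->; ring.
exact: (alg _ _ _ _ _ _ _ _ _ _ _ _ _ _ _ _ _ _ (D X Y Z vY vZ) (D Y Z X vZ vX)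
  (D Z X Y vX vY) (L X Y Z) (L Y Z X) (L Z X Y) (symq Y X Z) (symq Z X Y) (symq Z Y X)).
Qed.

End Closed.

(** * The Jacobi bracket *)

Section Lie.
Context {R : realType} {n : nat} {M : smoothManifold R n.*2.+1}.
Implicit Types (p : M) (i j : chart_idx M) (f g h : M -> R).
Variable a : diff_form M 1.
Hypothesis contact_a : strict_contact a.

Let oa : one_form a. Proof. by case: contact_a. Qed.
Let X f := contact_hamiltonian a f.
Let vX f : smooth f -> vector_field (X f).
Proof. by move=> sf; have [] := contact_hamiltonianP contact_a sf. Qed.
Let aX f : smooth f -> contract a (X f) = f.
Proof. by move=> sf; have [] := contact_hamiltonianP contact_a sf. Qed.

Lemma dform_hamiltonian f p i v : smooth f -> chart_dom i p ->
  dform a p i (X f p i) v = reeb_der a f p * a p i v - differential f p i v.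
Proof.
move=> sf ip; have [_ _ H] := contact_hamiltonianP contact_a sf.
by rewrite -(H p i ip v) interior_product_dform.
Qed.

Lemma alpha_lie_bracket f g p i : smooth f -> smooth g -> chart_dom i p ->
  a p i (lie_bracket (X f) (X g) p i) = field_der (X f) g p - reeb_der a f p * g p.
Proof.
move=> sf sg ip; rewrite (cartan_formula oa (vX sf) (vX sg) ip) (aX sf) (aX sg).
rewrite (dform_hamiltonian _ sf ip) -(contract_chart oa (vX sg) ip) (aX sg).
rewrite (field_der_chart (vX sf) sg ip) /differential.
by rewrite opprB addrA subrK.
Qed.

(** [[f, g] = X_f(g) - R(f) g]: Cartan's formula for [alpha], with [alpha(X_f) = f],
[alpha(X_g) = g] and [dalpha(X_f, X_g) = R(f) g - X_g(f)]. *)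
Lemma jacobi_bracketE f g : smooth f -> smooth g ->
  jacobi_bracket a f g = (fun p => field_der (X f) g p - reeb_der a f p * g p).
Proof.
move=> sf sg; apply/funext => p.
have cp := chart_at_dom p.
exact: alpha_lie_bracket.
Qed.

Lemma jacobi_bracket_smooth f g : smooth f -> smooth g ->
  smooth (jacobi_bracket a f g).
Proof.
move=> sf sg; rewrite jacobi_bracketE // => i; have io := @img_open _ _ M i.
exact: (smooth_on_sub io (field_der_smooth (vX sf) sg i)
  (smooth_on_mul io (reeb_der_smooth contact_a sf i) (sg i))).
Qed.

Lemma jacobi_bracket_anti f g :
  jacobi_bracket a g f = - (jacobi_bracket a f g : M -> R^o).
Proof.
apply/funext => p.
have cp := chart_at_dom p.
rewrite -[RHS]/(- jacobi_bracket a f g p) /jacobi_bracket /contract.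
have -> : lie_bracket (contact_hamiltonian a g) (contact_hamiltonian a f) p
    (chart_at p) = - lie_bracket (contact_hamiltonian a f)
      (contact_hamiltonian a g) p (chart_at p).
  by rewrite (lie_bracket_chart _ _ cp) (lie_bracket_chart _ _ cp) opprB.
exact: one_form_opp.
Qed.

(** This form of [dalpha(X_f, X_g)] contains no products of functions: when it is
differentiated along a third field, only the derivatives of [X_f(g)], [X_g(f)]
and [[f, g]] appear. *)
Lemma dform_hamiltonians f g p i : smooth f -> smooth g -> chart_dom i p ->
  dform a p i (X f p i) (X g p i) =
  field_der (X f) g p - field_der (X g) f p - jacobi_bracket a f g p.
Proof.
move=> sf sg ip; rewrite dform_hamiltonian // jacobi_bracketE //.
rewrite -(contract_chart oa (vX sg) ip) aX //.
rewrite -(contract_chart (one_form_differential sf) (vX sg) ip) -/(field_der _ _).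
ring.
Qed.

Lemma dform_lie_bracket f g h p i : smooth f -> smooth g -> smooth h ->
  chart_dom i p ->
  dform a p i (lie_bracket (X f) (X g) p i) (X h p i) =
  'D_(X f p i) (field_der (X g) h \o ichart i) (chart i p) -
  'D_(X g p i) (field_der (X f) h \o ichart i) (chart i p) -
  reeb_der a h p * jacobi_bracket a f g p.
Proof.
move=> sf sg sh ip; rewrite dform_anti dform_hamiltonian //.
rewrite (lie_bracket_der (vX sf) (vX sg) sh ip) alpha_lie_bracket //.
by rewrite jacobi_bracketE // opprB.
Qed.

Lemma derive_dform_hamiltonians f g u p i : smooth f -> smooth g -> chart_dom i p ->
  'D_u (dform_field a i (X f) (X g)) (chart i p) =
  'D_u (field_der (X f) g \o ichart i) (chart i p) -
  'D_u (field_der (X g) f \o ichart i) (chart i p) -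
  'D_u (jacobi_bracket a f g \o ichart i) (chart i p).
Proof.
move=> sf sg ip; have io := @img_open _ _ M i; have xi := chart_img_chart ip.
have d k : smooth k -> derivable (k \o ichart i) (chart i p) u.
  by move=> sk; apply: diff_derivable; exact: smooth_differentiable.
have d1 := d _ (field_der_smooth (vX sf) sg).
have d2 := d _ (field_der_smooth (vX sg) sf).
have d3 := d _ (jacobi_bracket_smooth sf sg).
rewrite -(deriveB d1 d2) -(deriveB (derivableB d1 d2) d3).
apply: near_eq_derive; apply: filterS (near_open io xi) => x /ichart_dom ix.
exact: dform_hamiltonians.
Qed.

Lemma jacobi_bracket_nested f g h p i : smooth f -> smooth g -> smooth h ->
  chart_dom i p ->
  jacobi_bracket a f (jacobi_bracket a g h) p =
  'D_(X f p i) (jacobi_bracket a g h \o ichart i) (chart i p) -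
  reeb_der a f p * jacobi_bracket a g h p.
Proof.
move=> sf sg sh ip; have sgh := jacobi_bracket_smooth sg sh.
by rewrite (jacobi_bracketE sf sgh) (field_der_chart (vX sf) sgh ip).
Qed.

(** Substitute the values of [dalpha] on Hamiltonian fields and on their Lie
brackets into [dform_closed].  All terms of the form [X_f(X_g(h))] cancel in the
cyclic sum, and what remains is that the cyclic sum of
[X_f([g, h]) - R(f) [g, h]] is zero. *)
Lemma jacobi_identity f g h p : smooth f -> smooth g -> smooth h ->
  jacobi_bracket a f (jacobi_bracket a g h) p +
  jacobi_bracket a g (jacobi_bracket a h f) p +
  jacobi_bracket a h (jacobi_bracket a f g) p = 0.
Proof.
move=> sf sg sh; have [i ip] := dom_cover p.
rewrite (jacobi_bracket_nested sf sg sh ip) (jacobi_bracket_nested sg sh sf ip).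
rewrite (jacobi_bracket_nested sh sf sg ip).
have alg (d1 d2 d3 l1 l2 l3 xyh yxh xzg zxg yzf zyf b1 b2 b3 rf rg rh
    bfg bgh bhf : R) :
  d1 + d2 + d3 = l1 + l2 + l3 ->
  d1 = xyh - xzg - b1 -> d2 = yzf - yxh - b2 -> d3 = zxg - zyf - b3 ->
  l1 = xyh - yxh - rh * bfg -> l2 = yzf - zyf - rf * bgh ->
  l3 = zxg - xzg - rg * bhf ->
  b1 - rf * bgh + (b2 - rg * bhf) + (b3 - rh * bfg) = 0.
  by move=> H *; subst; lra.
exact: (alg _ _ _ _ _ _ _ _ _ _ _ _ _ _ _ _ _ _ _ _ _
  (dform_closed oa (vX sf) (vX sg) (vX sh) ip)
  (derive_dform_hamiltonians (X f p i) sg sh ip)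
  (derive_dform_hamiltonians (X g p i) sh sf ip)
  (derive_dform_hamiltonians (X h p i) sf sg ip)
  (dform_lie_bracket sf sg sh ip) (dform_lie_bracket sg sh sf ip)
  (dform_lie_bracket sh sf sg ip)).
Qed.

End Lie.

Theorem proposition3p1p8 (R : realType) (n : nat)
    (M : smoothManifold R n.*2.+1) (alpha : diff_form M 1)
    (contact_alpha : strict_contact alpha) :
  lie_algebra_on (V := (M -> R^o)) [set f | smooth f] (jacobi_bracket alpha).
Proof.
(* Linearity in the second argument is visible on X_f(g) - R(f) g; antisymmetry
   transfers it to the first. *)
have linr (c : R) (x y z : M -> R^o) : smooth x -> smooth y -> smooth z ->
    jacobi_bracket alpha z (c *: x + y) =
    c *: (jacobi_bracket alpha z x : M -> R^o) + jacobi_bracket alpha z y.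
  move=> sx sy sz; have [vZ _ _] := contact_hamiltonianP contact_alpha sz.
  rewrite (jacobi_bracketE contact_alpha sz (smooth_linear c sx sy)).
  rewrite (jacobi_bracketE contact_alpha sz sx) (jacobi_bracketE contact_alpha sz sy).
  apply/funext => p; rewrite (field_der_linear c p vZ sx sy).
  rewrite -[(c *: x + y) p]/(c * x p + y p).
  have alg (fx fy r u v : R) :
    c * fx + fy - r * (c * u + v) = c * (fx - r * u) + (fy - r * v) by ring.
  exact: alg.
split=> /=.
- exact: smooth0.
- by move=> c x y; exact: smooth_linear.
- by move=> x y; exact: jacobi_bracket_smooth.
- move=> c x y z sx sy sz.
  rewrite (jacobi_bracket_anti contact_alpha z) (linr c x y z sx sy sz).
  rewrite (jacobi_bracket_anti contact_alpha z x) (jacobi_bracket_anti contact_alpha z y).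
  by rewrite opprD scalerN.
- exact: linr.
- move=> x _; have H := jacobi_bracket_anti contact_alpha x x.
  apply/funext => p; suff : jacobi_bracket alpha x x p = 0 :> R by [].
  have : jacobi_bracket alpha x x p = - jacobi_bracket alpha x x p.
    exact: (congr1 (fun k : M -> R => k p) H).
  by move: (jacobi_bracket _ _ _ p) => t; lra.
- move=> x y z sx sy sz; apply/funext => p.
  exact: (jacobi_identity contact_alpha).
Qed.
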